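(* Let $r_{BD}$ be a Belavin--Drinfeld $r$-matrix over $\overline F$ associated to the admissible triple $(\Gamma_1,\Gamma_2,\tau)$. If $\delta$ is a Lie bialgebra structure on $\mathfrak g=\mathfrak{su}(n,F,d)$ such that $\delta_{\overline F}$ is gauge equivalent to $\partial(\sqrt d\,r_{BD})$ over $\overline F$, then $\Gamma_1=\Gamma_2=\emptyset$.
   Context: $F$ is a field of characteristic zero, $d\in F^*\setminus {F^*}^2$, $K=F(\sqrt d)$, $\overline F$ an algebraic closure of $F$ containing $K$, $n$ a positive integer. For a matrix $A$ over $K$, $\overline A$ is obtained by applying the nontrivial element of $\mathrm{Gal}(K/F)$ to the entries. $\mathfrak{su}(n,F,d)=\{A\in\mathfrak{sl}(n,K):\overline A^T+A=0\}$, an $F$-Lie algebra with scalar extension $\mathfrak{sl}(n,\overline F)$ to $\overline F$. A Lie bialgebra structure on a Lie algebra $\mathfrak a$ is a linear map $\delta:\mathfrak a\to\mathfrak a\otimes\mathfrak a$ whose transpose is a Lie bracket on $\mathfrak a^*$ and which satisfies $\delta([a,b])=(\mathrm{ad}_a\otimes1+1\otimes\mathrm{ad}_a)\delta(b)-(\mathrm{ad}_b\otimes1+1\otimes\mathrm{ad}_b)\delta(a)$. For $r\in\mathfrak a\otimes\mathfrak a$, $\partial r$ is the map $a\mapsto[r,a\otimes1+1\otimes a]$. With $\mathrm{Ad}_X(A)=XAX^{-1}$, $\delta_{\overline F}$ is gauge equivalent to $\partial s$ over $\overline F$ if $\delta_{\overline F}=\partial((\mathrm{Ad}_X\otimes\mathrm{Ad}_X)(s))$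 for some $X\in\mathrm{GL}(n,\overline F)$. For $r=\sum a_i\otimes b_i$, $r^{21}=\sum b_i\otimes a_i$. Belavin--Drinfeld $r$-matrices for $\mathfrak{sl}(n,\overline F)$: let $\mathfrak h$ be the diagonal Cartan subalgebra, $\Delta^+$ the positive roots with upper triangular root vectors, $\Gamma=\{\alpha_1,\dots,\alpha_{n-1}\}$ the simple roots, $e_\alpha$ the root vectors given by the matrix units $E_{ij}$ ($i\ne j$), $\Omega$ the Casimir element with respect to the trace form, and $\Omega_0$ its component in $\mathfrak h\otimes\mathfrak h$. An admissible triple $(\Gamma_1,\Gamma_2,\tau)$ consists of $\Gamma_1,\Gamma_2\subseteq\Gamma$ and an isometric bijection $\tau:\Gamma_1\to\Gamma_2$ such that for each $\alpha\in\Gamma_1$ some $\tau^k(\alpha)\notin\Gamma_1$. A Belavin--Drinfeld $r$-matrix associated to it is $r_{BD}=r_0+r_1$ with $r_0\in\mathfrak h\otimes\mathfrak h$, $r_0+r_0^{21}=\Omega_0$, $(\tau(\alpha)\otimes\mathrm{Id}+\mathrm{Id}\otimes\alpha)(r_0)=0$ for all $\alpha\in\Gamma_1$, and $r_1=\sum_{\alpha\in\Delta^+}e_\alpha\otimes e_{-\alpha}+\sum_{\alpha\in\mathrm{Span}(\Gamma_1)^+}\sum_{k\ge1}e_\alpha\wedge e_{-\tau^k(\alpha)}$, where $a\wedge b=a\otimes b-b\otimes a$, $\mathrm{Span}(\Gamma_1)^+$ is the set of positive roots in the span of $\Gamma_1$, the sum is over those $k$ for which $\tau^k(\alpha)$ is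 defined, and $e_{-\tau^k(\alpha)}$ means $\theta^k(e_{-\alpha})$, $\theta$ being the Lie algebra isomorphism (between the subalgebras generated by the $e_{\pm\alpha}$ with $\alpha\in\Gamma_1$, resp. $\Gamma_2$) with $e_{\pm\alpha}\mapsto e_{\pm\tau(\alpha)}$ for $\alpha\in\Gamma_1$. *)

(* Defs.v *)
From HB Require Import structures.
From mathcomp Require Import all_boot all_order all_algebra all_fingroup all_field.

Set Implicit Arguments.
Unset Strict Implicit.
Unset Printing Implicit Defensive.

Import GRing.Theory.
Local Open Scope ring_scope.

Lemma linfun_linearE (k : fieldType) (V W : vectType k) (f : V -> W) :
  linear f -> linfun f =1 f.
Proof.
move=> lin.
pose h := HB.pack_for {linear V -> W} f (GRing.isLinear.Build _ _ _ _ f lin).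
exact: (lfunE h).
Qed.

(* The tensor product of two finite-dimensional vector spaces, in coordinates *)
(* with respect to the products of the vectors of the chosen bases            *)
(* vbasis {:V} and vbasis {:W}; tlift_tens is its universal property.         *)
Definition tensor (k : fieldType) (V W : vectType k) : Type :=
  'M[k]_(\dim {:V}, \dim {:W}).

HB.instance Definition _ (k : fieldType) (V W : vectType k) :=
  Vector.copy (tensor V W) 'M[k]_(\dim {:V}, \dim {:W}).

Definition tens (k : fieldType) (V W : vectType k) (v : V) (w : W) :
    tensor V W :=
  \matrix_(i, j) (coord (vbasis {:V}) i v * coord (vbasis {:W}) j w).

(* The additive map with c *: (v (x) w) |-> sigma c *: b v w, for b additive  *)
(* and sigma-semilinear in both arguments.                                    *)
Definition tlift_semi (k k' : fieldType) (sigma : k -> k') (V W : vectType k)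
    (U : lmodType k') (b : V -> W -> U) (t : tensor V W) : U :=
  \sum_i \sum_j sigma ((t : 'M_(_, _)) i j) *:
    b (vbasis {:V})`_i (vbasis {:W})`_j.

Definition tlift (k : fieldType) (V W : vectType k) (U : lmodType k)
    (b : V -> W -> U) (t : tensor V W) : U :=
  tlift_semi id b t.

Lemma tlift_semi_tens (k k' : fieldType) (sigma : {rmorphism k -> k'})
    (V W : vectType k) (U : lmodType k') (b : V -> W -> U) :
    (forall c v v' w, b (c *: v + v') w = sigma c *: b v w + b v' w) ->
    (forall c v w w', b v (c *: w + w') = sigma c *: b v w + b v w') ->
  forall v w, tlift_semi sigma b (tens v w) = b v w.
Proof.
move=> bl br v w.
have b0l w' : b 0 w' = 0.
  by have := bl (-1) 0 0 w'; rewrite scaler0 addr0 rmorphN1 scaleN1r addNr.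
have b0r v' : b v' 0 = 0.
  by have := br (-1) v' 0 0; rewrite scaler0 addr0 rmorphN1 scaleN1r addNr.
have suml (I : Type) (r : seq I) (c : I -> k) (x : I -> V) w' :
    b (\sum_(i <- r) c i *: x i) w' = \sum_(i <- r) sigma (c i) *: b (x i) w'.
  by elim: r => [|i r IH]; rewrite ?big_nil // !big_cons bl IH.
have sumr (I : Type) (r : seq I) (c : I -> k) (x : I -> W) v' :
    b v' (\sum_(i <- r) c i *: x i) = \sum_(i <- r) sigma (c i) *: b v' (x i).
  by elim: r => [|i r IH]; rewrite ?big_nil // !big_cons br IH.
rewrite [in RHS](coord_vbasis (memvf v)) suml; apply: eq_bigr => i _.
rewrite [in RHS](coord_vbasis (memvf w)) sumr scaler_sumr.
by apply: eq_bigr => j _; rewrite mxE rmorphM scalerA.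
Qed.

Lemma tlift_tens (k : fieldType) (V W : vectType k) (U : lmodType k)
    (b : V -> W -> U) :
    (forall w, linear (b^~ w)) -> (forall v, linear (b v)) ->
  forall v w, tlift b (tens v w) = b v w.
Proof.
by move=> bl br; apply: (@tlift_semi_tens k k idfun V W U b) => *;
  [apply: bl | apply: br].
Qed.

Lemma tlift_linear (k : fieldType) (V W : vectType k) (U : lmodType k)
    (b : V -> W -> U) : linear (tlift b : tensor V W -> U).
Proof.
move=> c s t; rewrite /tlift /tlift_semi scaler_sumr -big_split /=.
apply: eq_bigr => i _; rewrite scaler_sumr -big_split /=.
by apply: eq_bigr => j _; rewrite !mxE scalerDl scalerA.
Qed.

Definition tmap (k : fieldType) (V W : vectType k) (f g : V -> W)
    (t : tensor V V) : tensor W W :=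
  tlift (fun x y => tens (f x) (g y)) t.

Definition tflip (k : fieldType) (V : vectType k) (t : tensor V V) :
    tensor V V :=
  tlift (fun x y => tens y x) t.

Definition twedge (k : fieldType) (V : vectType k) (x y : V) : tensor V V :=
  tens x y - tens y x.

Definition is_lie_bracket (k : fieldType) (V : lmodType k)
    (br : V -> V -> V) : Prop :=
  [/\ forall y, linear (br^~ y),
      forall x, linear (br x),
      forall x, br x x = 0
    & forall x y z, br x (br y z) + br y (br z x) + br z (br x y) = 0].

Definition transpose_bracket (k : fieldType) (V : vectType k)
    (delta : V -> tensor V V) (f g : 'Hom(V, k^o)) : 'Hom(V, k^o) :=
  linfun (fun a : V => tlift (fun x y : V => f x * g y : k^o) (delta a)).

Lemma transpose_bracketE (k : fieldType) (V : vectType k)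
    (delta : 'Hom(V, tensor V V)) (f g : 'Hom(V, k^o)) (a : V) :
  transpose_bracket delta f g a =
    tlift (fun x y : V => f x * g y : k^o) (delta a).
Proof.
by apply: linfun_linearE => c u v; rewrite linearP tlift_linear.
Qed.

Definition ad_tens (k : fieldType) (V : vectType k) (br : V -> V -> V) (a : V)
    (t : tensor V V) : tensor V V :=
  tmap (br a) id t + tmap id (br a) t.

Definition is_lie_bialgebra (k : fieldType) (V : vectType k)
    (br : V -> V -> V) (delta : 'Hom(V, tensor V V)) : Prop :=
  is_lie_bracket (transpose_bracket delta) /\
  forall a b, delta (br a b) =
    ad_tens br a (delta b) - ad_tens br b (delta a).

(* a |-> [r, a (x) 1 + 1 (x) a]                                               *)
Definition coboundary (k : fieldType) (V : vectType k) (br : V -> V -> V)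
    (r : tensor V V) (a : V) : tensor V V :=
  tmap (br^~ a) id r + tmap id (br^~ a) r.

(* 'M[K]_n as a vector space over the subfield F of K.                        *)
Definition mx_over (F : fieldType) (K : fieldExtType F) (n : nat) : Type :=
  'M[K]_n.

Section MxOver.
Variables (F : fieldType) (K : fieldExtType F) (n : nat).

HB.instance Definition _ := GRing.Zmodule.on (mx_over K n).

Definition mx_over_scale (c : F) (A : mx_over K n) : mx_over K n :=
  c%:A *: (A : 'M[K]_n).

Fact mx_over_scaleA a b A :
  mx_over_scale a (mx_over_scale b A) = mx_over_scale (a * b) A.
Proof. by rewrite /mx_over_scale scalerA -scalerAl mul1r scalerA. Qed.

Fact mx_over_scale1 : left_id 1 mx_over_scale.
Proof. by move=> A; rewrite /mx_over_scale !scale1r. Qed.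

Fact mx_over_scaleDr : right_distributive mx_over_scale +%R.
Proof. by move=> a A B; rewrite /mx_over_scale scalerDr. Qed.

Fact mx_over_scaleDl A : {morph mx_over_scale^~ A : a b / a + b}.
Proof. by move=> a b; rewrite /mx_over_scale !scalerDl. Qed.

HB.instance Definition _ := GRing.Zmodule_isLmodule.Build F (mx_over K n)
  mx_over_scaleA mx_over_scale1 mx_over_scaleDr mx_over_scaleDl.

Let V := {ffun 'I_n * 'I_n -> K}.

Fact mx_over_vect_iso : Vector.axiom (\dim {:V}) (mx_over K n).
Proof.
pose ff (A : mx_over K n) : V := [ffun p => (A : 'M[K]_n) p.1 p.2].
pose gg (f : V) : mx_over K n := \matrix_(i, j) f (i, j).
exists (fun A => \row_i coord (vbasis {:V}) i (ff A)).
  have lin : linear ff.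
    by move=> c A B; apply/ffunP=> p; rewrite !ffunE !mxE -scalerAl mul1r.
  by move=> c A B; apply/rowP=> i; rewrite !mxE lin linearP.
exists (fun v : 'rV[F]_(\dim {:V}) => gg (\sum_i v 0 i *: (vbasis {:V})`_i)) => [A|v].
  apply/matrixP=> i j; rewrite mxE.
  under eq_bigr => l _ do rewrite mxE.
  by rewrite -(coord_vbasis (memvf (ff A))) ffunE.
apply/rowP=> i; rewrite mxE.
have -> : ff (gg (\sum_i v 0 i *: (vbasis {:V})`_i)) =
    \sum_i v 0 i *: (vbasis {:V})`_i.
  by apply/ffunP=> -[a b]; rewrite ffunE mxE.
by rewrite coord_sum_free // (basis_free (vbasisP _)).
Qed.

HB.instance Definition _ :=
  Lmodule_hasFinDim.Build F (mx_over K n) mx_over_vect_iso.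

End MxOver.

Section SpecialUnitary.
Variables (F : fieldType) (K : splittingFieldType F) (n : nat).
Variable sigma : gal_of {:K}.

Definition su_trace (A : mx_over K n) : K := \tr (A : 'M[K]_n).
Definition su_skew (A : mx_over K n) : mx_over K n :=
  (map_mx sigma (A : 'M[K]_n))^T + A.

Definition su : {vspace mx_over K n} :=
  (lker (linfun su_trace) :&: lker (linfun su_skew))%VS.

Lemma mem_su (A : 'M[K]_n) :
  (A : mx_over K n) \in su = (\tr A == 0) && ((map_mx sigma A)^T + A == 0).
Proof.
have lt : linear su_trace.
  move=> c X Y; rewrite /su_trace linearD /=; congr (_ + _).
  by rewrite [LHS](mxtraceZ (c%:A)) -scalerAl mul1r.
have ls : linear su_skew.
  move=> c X Y; apply/matrixP => i j.
  by rewrite !mxE rmorphD rmorphM /= linearZ /= rmorph1 mulrDr addrACA.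
rewrite memv_cap !memv_ker (linfun_linearE lt) (linfun_linearE ls).
by [].
Qed.

Definition su_bracket (A B : subvs_of su) : subvs_of su :=
  vsproj su ((vsval A : 'M[K]_n) *m (vsval B : 'M[K]_n)
             - (vsval B : 'M[K]_n) *m (vsval A : 'M[K]_n) : 'M[K]_n).

Lemma su_bracketE (A B : subvs_of su) :
  vsval (su_bracket A B) =
    (vsval A : 'M[K]_n) *m (vsval B : 'M[K]_n)
    - (vsval B : 'M[K]_n) *m (vsval A : 'M[K]_n) :> 'M[K]_n.
Proof.
rewrite vsprojK // mem_su linearB /= mxtrace_mulC subrr eqxx /=.
have skew (C : subvs_of su) :
    (map_mx sigma (vsval C : 'M[K]_n))^T = - (vsval C : 'M[K]_n).
  by have := subvsP C; rewrite mem_su => /andP[_]; rewrite addr_eq0 => /eqP.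
rewrite map_mxB !map_mxM linearB /= !trmx_mul !skew !mulNmx !mulmxN !opprK.
by rewrite addrA subrK subrr.
Qed.

End SpecialUnitary.

Section SpecialLinear.
Variables (k : fieldType) (n : nat).

Definition sl : {vspace 'M[k]_n} := lker (linfun (mxtrace : 'M[k]_n -> k^o)).

Lemma mem_sl (A : 'M[k]_n) : (A \in sl) = (\tr A == 0).
Proof. by rewrite memv_ker lfunE. Qed.

Definition sl_bracket (A B : subvs_of sl) : subvs_of sl :=
  vsproj sl (vsval A *m vsval B - vsval B *m vsval A).

Lemma sl_bracketE (A B : subvs_of sl) :
  vsval (sl_bracket A B) = vsval A *m vsval B - vsval B *m vsval A.
Proof. by rewrite vsprojK // mem_sl linearB /= mxtrace_mulC subrr. Qed.

Definition Ad (X : 'M[k]_n) (A : subvs_of sl) : subvs_of sl :=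
  vsproj sl (X *m vsval A *m invmx X).

Lemma AdE (X : 'M[k]_n) (A : subvs_of sl) :
  X \in unitmx -> vsval (Ad X A) = X *m vsval A *m invmx X.
Proof.
move=> uX; rewrite vsprojK // mem_sl mxtrace_mulC mulmxA mulVmx // mul1mx.
by rewrite -mem_sl subvsP.
Qed.

Definition gauge_equivalent
    (delta : subvs_of sl -> tensor (subvs_of sl) (subvs_of sl))
    (s : tensor (subvs_of sl) (subvs_of sl)) : Prop :=
  exists2 X : 'M[k]_n, X \in unitmx &
    forall a, delta a = coboundary sl_bracket (tmap (Ad X) (Ad X) s) a.

End SpecialLinear.

Section ScalarExtension.
Variables (F : fieldType) (K : splittingFieldType F) (n : nat).
Variables (sigma : gal_of {:K}) (L : fieldType) (j : {rmorphism K -> L}).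

Definition su_to_sl (A : subvs_of (su n sigma)) : subvs_of (sl L n) :=
  vsproj (sl L n) (map_mx j (vsval A : 'M[K]_n)).

Lemma su_to_slE (A : subvs_of (su n sigma)) :
  vsval (su_to_sl A) = map_mx j (vsval A : 'M[K]_n).
Proof.
rewrite vsprojK // mem_sl trace_map_mx fmorph_eq0.
by have := subvsP A; rewrite mem_su => /andP[].
Qed.

(* deltaL is the L-linear extension of delta, for su (x)_F L identified with  *)
(* sl(n, L) by A (x) c |-> c *: su_to_sl A.                                   *)
Definition is_scalar_extension
    (delta : 'Hom(subvs_of (su n sigma),
                  tensor (subvs_of (su n sigma)) (subvs_of (su n sigma))))
    (deltaL : 'Hom(subvs_of (sl L n),
                   tensor (subvs_of (sl L n)) (subvs_of (sl L n)))) : Prop :=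
  forall A, deltaL (su_to_sl A) =
    tlift_semi (fun c : F => j c%:A)
      (fun x y => tens (su_to_sl x) (su_to_sl y)) (delta A).

End ScalarExtension.

(* The root eps_i - eps_j of sl(n) is the pair (i, j), i != j; its root       *)
(* vector is the matrix unit E_ij. The rational span of the roots is realized *)
(* in row vectors, where the form induced by the trace form on the dual of h  *)
(* is the standard one.                                                       *)
Section Roots.
Variable n : nat.
Implicit Types a b : 'I_n * 'I_n.

Definition positive a : bool := (a.1 < a.2)%N.
Definition simple_roots : {set 'I_n * 'I_n} :=
  [set a : 'I_n * 'I_n | a.2 == a.1.+1 :> nat].
Definition oppr_root a : 'I_n * 'I_n := (a.2, a.1).
Definition root_row a : 'rV[rat]_n := delta_mx 0 a.1 - delta_mx 0 a.2.
Definition root_form a b : rat := (root_row a *m (root_row b)^T) 0 0.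

Definition admissible_triple (G1 G2 : {set 'I_n * 'I_n})
    (tau : 'I_n * 'I_n -> 'I_n * 'I_n) : Prop :=
  [/\ G1 \subset simple_roots, G2 \subset simple_roots,
      {in G1 &, injective tau} /\ tau @: G1 = G2,
      {in G1 &, forall a b, root_form (tau a) (tau b) = root_form a b}
    & {in G1, forall a, exists m, iter m tau a \notin G1}].

Definition root_span (G1 : {set 'I_n * 'I_n}) : {vspace 'rV[rat]_n} :=
  <<image_tuple root_row G1>>%VS.

(* The linear extension of tau to the span of G1.                             *)
Definition tau_ext (G1 : {set 'I_n * 'I_n})
    (tau : 'I_n * 'I_n -> 'I_n * 'I_n) (v : 'rV[rat]_n) : 'rV[rat]_n :=
  \sum_(i < #|G1|)
    coord (image_tuple root_row G1) i v *: root_row (tau (enum_val i)).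

(* tau^m(a) is defined.                                                       *)
Definition tau_defined (G1 : {set 'I_n * 'I_n})
    (tau : 'I_n * 'I_n -> 'I_n * 'I_n) (m : nat) a : bool :=
  [forall l : 'I_m, iter l (tau_ext G1 tau) (root_row a) \in root_span G1].

End Roots.

Section BelavinDrinfeld.
Variables (k : fieldType) (n : nat).
Notation g := (subvs_of (sl k n)).
Implicit Types (x y : g) (a : 'I_n * 'I_n).

Definition cartan x : bool := is_diag_mx (vsval x).

Definition cartan_proj x : g := vsproj (sl k n) (diag_mx (\row_i vsval x i i)).

Lemma cartan_projE x : vsval (cartan_proj x) = diag_mx (\row_i vsval x i i).
Proof.
rewrite vsprojK // mem_sl mxtrace_diag; under eq_bigr do rewrite mxE.
by rewrite -/(mxtrace _) -mem_sl subvsP.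
Qed.

Definition root_vec a : g := vsproj (sl k n) (delta_mx a.1 a.2).

Lemma root_vecE a : a.1 != a.2 -> vsval (root_vec a) = delta_mx a.1 a.2.
Proof.
move=> na; rewrite vsprojK // mem_sl /mxtrace big1 // => i _; rewrite mxE.
by case: eqP => //= ->; rewrite (negPf na).
Qed.

(* The root as a linear form on the Cartan subalgebra.                        *)
Definition root_eval a x : k := vsval x a.1 a.1 - vsval x a.2 a.2.

Definition in_cartan_tensor (t : tensor g g) : Prop :=
  exists2 s : seq (g * g),
    all (fun p => cartan p.1 && cartan p.2) s & t = \sum_(p <- s) tens p.1 p.2.

(* The inverse of the trace form on sl(n): sum_ij g^ij u_i (x) u_j, (u_i)     *)
(* being a basis and (g^ij) the inverse of its Gram matrix.                   *)
Definition casimir : tensor g g :=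
  invmx (\matrix_(i, j)
    \tr (vsval (vbasis {:g})`_i *m vsval (vbasis {:g})`_j)).

Definition casimir0 : tensor g g := tmap cartan_proj cartan_proj casimir.

Definition generated_subalgebra (S : g -> Prop) x : Prop :=
  forall U : {vspace g}, (forall s, S s -> s \in U) ->
    {in U &, forall y z, sl_bracket y z \in U} -> x \in U.

Definition simple_vectors (G1 : {set 'I_n * 'I_n}) x : Prop :=
  exists2 a, a \in G1 & x = root_vec a \/ x = root_vec (oppr_root a).

(* Only the restriction of theta to the subalgebra generated by the e_{+-a},  *)
(* a in G1, matters.                                                          *)
Definition is_theta (G1 G2 : {set 'I_n * 'I_n})
    (tau : 'I_n * 'I_n -> 'I_n * 'I_n) (theta : 'End(g)) : Prop :=
  let g1 := generated_subalgebra (simple_vectors G1) in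
  let g2 := generated_subalgebra (simple_vectors G2) in
  [/\ forall x y, g1 x -> g1 y ->
        theta (sl_bracket x y) = sl_bracket (theta x) (theta y),
      forall x y, g1 x -> g1 y -> theta x = theta y -> x = y,
      forall y, g2 y <-> exists2 x, g1 x & theta x = y
    & {in G1, forall a, theta (root_vec a) = root_vec (tau a) /\
        theta (root_vec (oppr_root a)) = root_vec (oppr_root (tau a))}].

(* tau^m(a) is never defined for m > #|G1|, for any a and any admissible      *)
(* triple, hence the bound on m.                                              *)
Definition bd_r1 (G1 : {set 'I_n * 'I_n})
    (tau : 'I_n * 'I_n -> 'I_n * 'I_n) (theta : 'End(g)) : tensor g g :=
  \sum_(a : 'I_n * 'I_n | positive a)
    tens (root_vec a) (root_vec (oppr_root a))
  + \sum_(a : 'I_n * 'I_n | positive a && (root_row a \in root_span G1))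
      \sum_(1 <= m < #|G1|.+1 | tau_defined G1 tau m a)
        twedge (root_vec a) (iter m theta (root_vec (oppr_root a))).

Definition is_bd_r0 (G1 : {set 'I_n * 'I_n})
    (tau : 'I_n * 'I_n -> 'I_n * 'I_n) (r0 : tensor g g) : Prop :=
  [/\ in_cartan_tensor r0, r0 + tflip r0 = casimir0
    & {in G1, forall a,
        tlift (fun x y => root_eval (tau a) x *: y + root_eval a y *: x) r0
          = 0}].

Definition is_bd_rmatrix (G1 G2 : {set 'I_n * 'I_n})
    (tau : 'I_n * 'I_n -> 'I_n * 'I_n) (r : tensor g g) : Prop :=
  exists r0 : tensor g g, exists theta : 'End(g),
    [/\ is_bd_r0 G1 tau r0, is_theta G1 G2 tau theta
      & r = r0 + bd_r1 G1 tau theta].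

End BelavinDrinfeld.

(* Main.v *)
(* Extend sigma to an endomorphism gam of Fbar and put theta A = -(A^gam)^T,   *)

(* The twist [theta] A = -(gam A)^T, where [gam] extends [sigma] to Fbar ([rmorphism_extension]), is
   a semilinear Lie endomorphism of sl(n, Fbar) fixing su pointwise; [tw] is its tensor square. Put
   s = (Ad_X (x) Ad_X)(r_BD). The values of delta on su are fixed by [tw], while sqrt d changes
   sign, so the coboundary of s + tw s vanishes on su, hence everywhere, because su spans sl over
   Fbar ([ad_invariant_su], [coboundary_twist]). Ad-invariant bilinear forms on matrices are
   symmetric ([invariant_form_sym]), and s + s^21 is the Casimir element ([ev_bd_sym]), which [tw]
   fixes; together these give tw s = s^21 ([tw_flip]).

   So [theta] carries the right support of s into its left support. For r_BD itself this says that
   if M is in the right support and has entries fixed by [gam], then M^T lies in Z L Z^-1, with L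
   the left support and Z = (gam X)^T X ([support_conj]).

   The two supports are too asymmetric for that. For a simple root b outside G2, L preserves the
   span V of the basis vectors of index at most b.1 ([contl_parabolic]). The right support contains
   e_(-c) for every simple c ([right_support_neg_simple]), and e_b if moreover b is in G1
   ([right_support_source]). Then Z V would be stable under every e_c and under e_(-b), which no
   space of that dimension is ([parabolic_flag]). Hence G1 is contained in G2; the cardinalities
   agree, so [tau] permutes G1, and nilpotency of [tau] leaves only the empty set. *)
(* the semilinear map fixing su pointwise. Since delta is defined over su and *)
(* gam changes the sign of sqrt d, for s = Ad_X r_BD the element              *)
(* s + theta(s) is ad-invariant, hence symmetric; as s + s^21 is the Casimir  *)
(* element, which theta fixes, this forces theta(s) = s^21. Hence conjugation *)
(* by Z = (X^gam)^T X carries the left support of r_BD to the transpose of    *)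
(* its right support. The left support lies in the parabolic subalgebra of    *)
(* G2, so it preserves the span V of the first p + 1 basis vectors whenever   *)
(* the p-th simple root b is not in G2. The right support contains e_(-a) for *)
(* all simple roots a, and also e_b if b is in G1 but not in G2; so for such  *)
(* a b, Z V is stable under all e_a, hence equal to V, and under e_(-b),      *)
(* which is absurd. Thus G1 is contained in G2 = tau(G1), so G1 = G2, and the *)
(* nilpotency of tau leaves only the empty set.                               *)
From HB Require Import structures.
From mathcomp Require boolp classical_sets.
Require Import Defs.
From mathcomp Require Import all_boot all_order all_algebra all_fingroup all_field.
From mathcomp Require Import ring zify.

Set Implicit Arguments.
Unset Strict Implicit.
Unset Printing Implicit Defensive.

Import GRing.Theory.
Local Open Scope ring_scope.

(** * Extension of embeddings into an algebraically closed field *)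

Section ExtendEmbedding.
Variables (K M : fieldType) (L : closedFieldType).
Variables (iota : {rmorphism K -> M}) (f : {rmorphism K -> L}).
Hypothesis iota_alg : forall x, algebraicOver iota x.
Implicit Types (G : M * L -> Prop) (p : {poly M}) (q : {poly L}).

(** The graph of a ring homomorphism extending f, defined on a subring of M that contains the image
    of K; the last clause makes it single-valued. Graphs are ordered by inclusion, as Zorn's lemma
    wants. *)
Definition partial_hom G :=
  [/\ forall c, G (iota c, f c),
      forall u v, G u -> G v -> G (u.1 - v.1, u.2 - v.2),
      forall u v, G u -> G v -> G (u.1 * v.1, u.2 * v.2)
    & forall y, G (0, y) -> y = 0].

Definition poly_graph G p q := forall i, G (p`_i, q`_i).

Section PartialHom.
Variable G : M * L -> Prop.
Hypothesis homG : partial_hom G.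

Lemma partial_hom_base c : G (iota c, f c).
Proof. by case: homG. Qed.

Lemma partial_hom0 : G (0, 0).
Proof. by have := partial_hom_base 0; rewrite !rmorph0. Qed.

Lemma partial_hom1 : G (1, 1).
Proof. by have := partial_hom_base 1; rewrite !rmorph1. Qed.

Lemma partial_homB x y x' y' : G (x, y) -> G (x', y') -> G (x - x', y - y').
Proof. by case: homG => _ + _ _ Gu Gv => /(_ _ _ Gu Gv). Qed.

Lemma partial_homM x y x' y' : G (x, y) -> G (x', y') -> G (x * x', y * y').
Proof. by case: homG => _ _ + _ Gu Gv => /(_ _ _ Gu Gv). Qed.

Lemma partial_homD x y x' y' : G (x, y) -> G (x', y') -> G (x + x', y + y').
Proof.
move=> Gx Gx'; rewrite -[x']opprK -[y']opprK -[- x']sub0r -[- y']sub0r.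
by apply: partial_homB => //; apply: partial_homB => //; apply: partial_hom0.
Qed.

Lemma partial_hom_sum (I : Type) (r : seq I) (P : pred I) x y :
  (forall i, P i -> G (x i, y i)) ->
  G (\sum_(i <- r | P i) x i, \sum_(i <- r | P i) y i).
Proof.
move=> Gxy; apply: (big_ind2 (fun a b => G (a, b))) => // [|a b a' b'].
  exact: partial_hom0.
exact: partial_homD.
Qed.

Lemma partial_homX x y k : G (x, y) -> G (x ^+ k, y ^+ k).
Proof.
move=> Gxy; elim: k => [|k IHk]; first exact: partial_hom1.
by rewrite !exprS; apply: partial_homM.
Qed.

Lemma partial_hom_fun x y y' : G (x, y) -> G (x, y') -> y = y'.
Proof.
move=> Gy Gy'; have := partial_homB Gy Gy'; rewrite subrr => Gd.
by case: homG => _ _ _ /(_ _ Gd)/eqP; rewrite subr_eq0 => /eqP.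
Qed.

Lemma poly_graph_base (m : {poly K}) :
  poly_graph G (map_poly iota m) (map_poly f m).
Proof. by move=> i; rewrite !coef_map; apply: partial_hom_base. Qed.

Lemma poly_graph_horner p q x y :
  poly_graph G p q -> G (x, y) -> G (p.[x], q.[y]).
Proof.
move=> Gpq Gxy; pose N := maxn (size p) (size q).
rewrite (horner_coef_wide x (leq_maxl _ _ : (_ <= N)%N)).
rewrite (horner_coef_wide y (leq_maxr _ _ : (_ <= N)%N)).
by apply: partial_hom_sum => i _; apply: partial_homM => //; apply: partial_homX.
Qed.

Lemma poly_graphB p q p' q' :
  poly_graph G p q -> poly_graph G p' q' -> poly_graph G (p - p') (q - q').
Proof. by move=> Gp Gp' i; rewrite !coefB; apply: partial_homB. Qed.

Lemma poly_graphM p q p' q' :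
  poly_graph G p q -> poly_graph G p' q' -> poly_graph G (p * p') (q * q').
Proof.
move=> Gp Gp' i; rewrite !coefM.
by apply: partial_hom_sum => l _; apply: partial_homM.
Qed.

Lemma poly_graphC x y : G (x, y) -> poly_graph G x%:P y%:P.
Proof. by move=> Gxy i; rewrite !coefC; case: eqP => // _; apply: partial_hom0. Qed.

Lemma poly_graphXn k : poly_graph G 'X^k 'X^k.
Proof.
by move=> i; rewrite !coefXn; case: eqP => _; [apply: partial_hom1|apply: partial_hom0].
Qed.

(* A polynomial over K vanishing at x has its constant term sent to 0 when    *)
(* (x, 0) is in the graph, so it can be divided by X until nothing is left.   *)
Lemma partial_hom_inj x : G (x, 0) -> x = 0.
Proof.
move=> Gx0; apply/eqP/negPn/negP => x0; have [m m0 mx] := iota_alg x.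
have: forall N, (size m <= N)%N -> False; last by move=> /(_ _ (leqnn _)).
move=> N; elim: N m m0 mx => [|N IHN] m m0 mx szm.
  by move: szm; rewrite leqn0 size_poly_eq0 (negPf m0).
have c0: m.[0] = 0.
  have := poly_graph_horner (poly_graph_base m) Gx0.
  rewrite (rootP mx) -[in X in _.[X]](rmorph0 f) horner_map => G0.
  by apply/eqP; rewrite -(fmorph_eq0 f); apply/eqP; case: homG => _ _ _; apply.
have /factor_theorem [m' def_m] : root m 0 by apply/rootP.
rewrite subr0 in def_m; subst m.
move: m0; rewrite mulf_eq0 polyX_eq0 orbF => m0.
apply: (IHN m' m0); last by move: szm; rewrite size_mulX.
by move: mx; rewrite rmorphM /= map_polyX rootM rootX (negPf x0) orbF.
Qed.

Lemma poly_graph_size p q : poly_graph G p q -> size p = size q.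
Proof.
move=> Gpq; apply/eqP; rewrite eqn_leq; apply/andP; split.
  apply/leq_sizeP => i /leq_sizeP le; apply: partial_hom_inj.
  by rewrite -(le i (leqnn i)); apply: Gpq.
apply/leq_sizeP => i /leq_sizeP le; case: homG => _ _ _; apply.
by rewrite -(le i (leqnn i)); apply: Gpq.
Qed.

(** A relation of least degree for x over the domain of G stands in for the minimal polynomial. The
    domain is only known to be a ring, so p need not be monic. *)
Lemma min_poly_graph x : exists p q,
  [/\ poly_graph G p q, p != 0, root p x
    & forall p' q', poly_graph G p' q' -> root p' x ->
        (size p' < size p)%N -> p' = 0].
Proof.
pose Q s := boolp.asbool (exists p q,
  [/\ poly_graph G p q, p != 0, root p x & size p = s]).
have exQ : exists s, Q s.
  have [m m0 mx] := iota_alg x.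
  exists (size (map_poly iota m)); apply/boolp.asboolP.
  exists (map_poly iota m), (map_poly f m); split=> //.
    exact: poly_graph_base.
  by rewrite map_poly_eq0.
have [s /boolp.asboolP [p [q [Gpq p0 px sp]]] smin] := ex_minnP exQ.
exists p, q; split=> // p' q' Gp' px'; apply: contraTeq => p0'.
rewrite -leqNgt sp smin //; apply/boolp.asboolP.
by exists p', q'; split.
Qed.

(* Pseudo-division by the minimal pair (p, q). *)
Lemma poly_graph_root x p q y :
  poly_graph G p q -> p != 0 -> root p x ->
  (forall p' q', poly_graph G p' q' -> root p' x ->
     (size p' < size p)%N -> p' = 0) ->
  root q y ->
  forall p' q', poly_graph G p' q' -> root p' x -> root q' y.
Proof.
move=> Gpq p0 px pmin qy p' q'.
move: {2}(size p') (leqnn (size p')) => N; elim: N p' q' => [|N IHN] p' q' szp' Gp' px'.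
  have sq' : size q' = 0 by apply/eqP; rewrite -leqn0 -(poly_graph_size Gp').
  by move/eqP: sq'; rewrite size_poly_eq0 => /eqP->; rewrite root0.
have [lt|le] := ltnP (size p') (size p).
  have p'0 := pmin _ _ Gp' px' lt.
  have sq' : size q' = 0 by rewrite -(poly_graph_size Gp') p'0 size_poly0.
  by move/eqP: sq'; rewrite size_poly_eq0 => /eqP->; rewrite root0.
have sq := poly_graph_size Gpq; have sq' := poly_graph_size Gp'.
pose k := (size p' - size p)%N.
have Glc : G (lead_coef p, lead_coef q) by rewrite /lead_coef -sq; apply: Gpq.
have Glc' : G (lead_coef p', lead_coef q') by rewrite /lead_coef -sq'; apply: Gp'.
have lq0 : lead_coef q != 0.
  by rewrite lead_coef_eq0 -size_poly_eq0 -sq size_poly_eq0.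
pose p2 := (lead_coef p)%:P * p' - (lead_coef p')%:P * 'X^k * p.
pose q2 := (lead_coef q)%:P * q' - (lead_coef q')%:P * 'X^k * q.
have G2 : poly_graph G p2 q2.
  apply: poly_graphB; first by apply: poly_graphM => //; apply: poly_graphC.
  apply: poly_graphM => //; apply: poly_graphM; last exact: poly_graphXn.
  exact: poly_graphC.
have r2 : root p2 x.
  rewrite /root /p2 !hornerE (rootP px) (rootP px') !mulr0 subrr.
  by rewrite eqxx.
have s2 : (size p2 <= N)%N.
  have p'gt0 : (0 < size p')%N by apply: leq_trans le; rewrite size_poly_gt0.
  apply: (@leq_trans (size p').-1); last by rewrite -ltnS prednK.
  apply/leq_sizeP => i lei; rewrite /p2 coefB coefCM -mulrA coefCM.
  rewrite coefXnM; case: ltnP => [ltk|_].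
    have : (k <= (size p').-1)%N by rewrite -subn1 leq_sub2l ?size_poly_gt0.
    by move=> /(leq_trans ltk)/leq_trans/(_ lei); rewrite ltnn.
  have [ei|nei] := eqVneq i (size p').-1.
    rewrite ei -/(lead_coef p').
    have -> : ((size p').-1 - k)%N = (size p).-1.
      have pgt0 : (0 < size p)%N by rewrite size_poly_gt0.
      rewrite /k; move: le p'gt0 pgt0; case: (size p') => // a; case: (size p) => // b.
      by rewrite !ltnS subSS => le _ _ /=; rewrite subKn.
    by rewrite -/(lead_coef p) mulrC subrr.
  have lti : (size p' <= i)%N.
    by rewrite -(prednK p'gt0) ltn_neqAle eq_sym nei lei.
  have lti2 : (size p <= i - k)%N.
    by rewrite leq_subRL ?subnK //; apply: leq_trans lti; rewrite leq_subr.
  by rewrite !nth_default ?mulr0 ?subrr.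
have := IHN _ _ s2 G2 r2.
rewrite /root /q2 !hornerE (rootP qy) mulr0 subr0 mulf_eq0 (negPf lq0).
by [].
Qed.

(** Adjoin x and send it to a root y of the image q of its minimal relation p. The pairs (p'(x),
    q'(y)) form a single-valued graph, since by [poly_graph_root] every relation satisfied by x is
    satisfied by y. *)
Lemma partial_hom_extend x : exists G',
  [/\ partial_hom G', forall u, G u -> G' u & exists y, G' (x, y)].
Proof.
have [p [q [Gpq p0 px pmin]]] := min_poly_graph x.
have [y qy] : exists y, root q y.
  apply/closed_rootP; rewrite -(poly_graph_size Gpq); apply: contraTneq px => s1.
  have [c c0 ->] : exists2 c, c != 0 & p = c%:P.
    by apply/size_poly1P; rewrite s1.
  by rewrite rootC.
pose G' (u : M * L) := exists p' q', [/\ poly_graph G p' q', u.1 = p'.[x] & u.2 = q'.[y]].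
exists G'; split.
- split.
  + move=> c; exists (iota c)%:P, (f c)%:P; rewrite !hornerC; split=> //.
    exact/poly_graphC/partial_hom_base.
  + move=> _ _ [p1 [q1 [G1 /= -> ->]]] [p2 [q2 [G2 /= -> ->]]].
    exists (p1 - p2), (q1 - q2); rewrite !hornerE; split=> //.
    exact: poly_graphB.
  + move=> _ _ [p1 [q1 [G1 /= -> ->]]] [p2 [q2 [G2 /= -> ->]]].
    exists (p1 * p2), (q1 * q2); rewrite !hornerE; split=> //.
    exact: poly_graphM.
  + move=> _ [p1 [q1 [G1 /= /esym/rootP r1 ->]]].
    exact/rootP/(poly_graph_root Gpq p0 px pmin qy G1 r1).
- move=> [a b] Gab; exists a%:P, b%:P; rewrite !hornerC; split=> //.
  exact: poly_graphC.
exists y, 'X, 'X; rewrite !hornerX; split=> //.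
by rewrite -['X]expr1 -[X in poly_graph _ _ X]expr1; apply: poly_graphXn.
Qed.

End PartialHom.

Lemma rmorphism_extension : exists g : {rmorphism M -> L}, forall c, g (iota c) = f c.
Proof.
(* The guard admits the empty relation, which is the union of the empty chain. A maximal G is
   nonempty, since otherwise the graph of f would be larger. *)
pose P G := (exists u, G u) -> partial_hom G.
have [|G [PG Gmax]] := @classical_sets.Zorn_bigcup (M * L)%type P.
  move=> F FP Ftot [u [G0 FG0 G0u]].
  have common u1 u2 : classical_sets.bigcup F id u1 ->
      classical_sets.bigcup F id u2 -> exists G, [/\ F G, G u1 & G u2].
    move=> [G1 F1 G1u] [G2 F2 G2u]; have [le|le] := Ftot _ _ F1 F2.
      by exists G2; split=> //; apply: le.
    by exists G1; split=> //; apply: le.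
  split.
  - move=> c; exists G0 => //.
    by have [|b _ _ _] := FP G0 FG0; [exists u|apply: b].
  - move=> u1 u2 /common c /c [G [FG Gu1 Gu2]]; exists G => //.
    by have [|_ b _ _] := FP G FG; [exists u1|apply: b].
  - move=> u1 u2 /common c /c [G [FG Gu1 Gu2]]; exists G => //.
    by have [|_ _ b _] := FP G FG; [exists u1|apply: b].
  - move=> y [G FG Gy].
    by have [|_ _ _ b] := FP G FG; [exists (0, y)|apply: b].
have homG : partial_hom G.
  have [/PG//|/boolp.forallNP noG] := boolp.EM (exists u, G u).
  pose B (u : M * L) := exists c, u = (iota c, f c).
  suff PB : P B.
    case: (Gmax B) => //; split; first by move=> u Gu; case: (noG u).
    by move/(_ (iota 0, f 0)) => sub; apply: (noG (iota 0, f 0)); apply: sub; exists 0.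
  move=> _; split.
  - by move=> c; exists c.
  - by move=> _ _ [c ->] [c' ->]; exists (c - c'); rewrite !rmorphB.
  - by move=> _ _ [c ->] [c' ->]; exists (c * c'); rewrite !rmorphM.
  - move=> y [c [c0 ->]]; have /eqP := esym c0; rewrite fmorph_eq0 => /eqP->.
    exact: rmorph0.
have total x : exists y, G (x, y).
  have [G' [homG' sGG' [y G'xy]]] := partial_hom_extend homG x.
  have [sG'G|nsub] := boolp.EM (forall u, G' u -> G u).
    by exists y; apply: sG'G.
  by case: (Gmax G').
have [g Gg] := boolp.choice total.
have gB : zmod_morphism g.
  move=> x y; apply: (partial_hom_fun homG (Gg _)).
  exact: partial_homB (Gg _) (Gg _).
have gM : monoid_morphism g.
  split; first by apply: (partial_hom_fun homG (Gg _)); apply: partial_hom1.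
  move=> x y; apply: (partial_hom_fun homG (Gg _)).
  exact: partial_homM (Gg _) (Gg _).
pose h := HB.pack_for {rmorphism M -> L} g
  (GRing.isZmodMorphism.Build _ _ g gB) (GRing.isMonoidMorphism.Build _ _ g gM).
exists h => c; apply: (partial_hom_fun homG (Gg _)).
exact: partial_hom_base.
Qed.

End ExtendEmbedding.

(** * Tensors as bilinear forms on matrices *)

Section TensorLift.
Variables (k : fieldType) (V W : vectType k).

Lemma tlift_semiD (k' : fieldType) (s : {rmorphism k -> k'}) (U : lmodType k')
    (b : V -> W -> U) (t t' : tensor V W) :
  tlift_semi s b (t + t') = tlift_semi s b t + tlift_semi s b t'.
Proof.
rewrite /tlift_semi -big_split /=; apply: eq_bigr => i _.
rewrite -big_split /=; apply: eq_bigr => l _.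
by rewrite !mxE rmorphD scalerDl.
Qed.

Lemma tlift_semiZ (k' : fieldType) (s : {rmorphism k -> k'}) (U : lmodType k')
    (b : V -> W -> U) c (t : tensor V W) :
  tlift_semi s b (c *: t) = s c *: tlift_semi s b t.
Proof.
rewrite /tlift_semi scaler_sumr; apply: eq_bigr => i _.
rewrite scaler_sumr; apply: eq_bigr => l _.
by rewrite !mxE rmorphM scalerA.
Qed.

Lemma eq_tlift_semi (k' : fieldType) (s : k -> k') (U : lmodType k')
    (b b' : V -> W -> U) (t : tensor V W) :
  (forall x y, b x y = b' x y) -> tlift_semi s b t = tlift_semi s b' t.
Proof.
by move=> eqb; apply: eq_bigr => i _; apply: eq_bigr => l _; rewrite eqb.
Qed.

Lemma tlift_comp (U U' : lmodType k) (h : {linear U -> U'})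
    (b : V -> W -> U) (t : tensor V W) :
  h (tlift b t) = tlift (fun x y => h (b x y)) t.
Proof.
rewrite /tlift /tlift_semi linear_sum; apply: eq_bigr => i _.
by rewrite linear_sum; apply: eq_bigr => l _; rewrite linearZ.
Qed.

Lemma tlift0 (U : lmodType k) (b : V -> W -> U) : tlift b 0 = 0.
Proof.
by rewrite /tlift /tlift_semi big1 // => i _; rewrite big1 // => l _;
  rewrite mxE scale0r.
Qed.

Lemma eq_tlift (U : lmodType k) (b b' : V -> W -> U) (t : tensor V W) :
  (forall x y, b x y = b' x y) -> tlift b t = tlift b' t.
Proof. exact: eq_tlift_semi. Qed.

End TensorLift.

Section BilinearForm.
Variables (k : fieldType) (n : nat).
Notation g := (subvs_of (sl k n)).
Implicit Types (P Q A X : 'M[k]_n) (x y a : g) (t r : tensor g g).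

(** Tensors are studied through the trace pairing with arbitrary matrices P and Q. [contr] contracts
    the left leg and keeps the right one, [contl] does the opposite; their images are the right and
    the left support. *)
Definition ev P Q t : k :=
  @tlift k g g k^o (fun x y => \tr (P *m vsval x) * \tr (Q *m vsval y)) t.
Definition contr P t : 'M[k]_n :=
  tlift (fun x y : g => \tr (P *m vsval x) *: vsval y) t.
Definition contl Q t : 'M[k]_n :=
  tlift (fun x y : g => \tr (Q *m vsval y) *: vsval x) t.

Lemma mxtrace_delta_mul (i l : 'I_n) (M : 'M[k]_n) : \tr (delta_mx i l *m M) = M l i.
Proof.
rewrite /mxtrace (bigD1 i) //= big1 => [|p np].
  rewrite mxE (bigD1 l) //= big1 => [|q nq].
    by rewrite mxE !eqxx mul1r !addr0.
  by rewrite mxE (negPf nq) andbF mul0r.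
by rewrite mxE big1 // => q _; rewrite mxE (negPf np) mul0r.
Qed.

Lemma mxtrace_mulP (A B : 'M[k]_n) :
  (forall Q, \tr (Q *m A) = \tr (Q *m B)) -> A = B.
Proof.
move=> eqAB; apply/matrixP => i j.
by have := eqAB (delta_mx j i); rewrite !mxtrace_delta_mul.
Qed.

Lemma ev_contr P Q t : ev P Q t = \tr (Q *m contr P t).
Proof.
rewrite /ev /contr (tlift_comp (mulmx Q)) (@tlift_comp _ _ _ _ k^o (@mxtrace k n)).
apply: (@eq_tlift _ _ _ k^o) => x y /=.
by rewrite -scalemxAr mxtraceZ.
Qed.

Lemma ev_contl P Q t : ev P Q t = \tr (P *m contl Q t).
Proof.
rewrite /ev /contl (tlift_comp (mulmx P)) (@tlift_comp _ _ _ _ k^o (@mxtrace k n)).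
apply: (@eq_tlift _ _ _ k^o) => x y /=.
by rewrite -scalemxAr mxtraceZ mulrC.
Qed.

Fact ev_is_scalar P Q : scalar (ev P Q).
Proof. by move=> c t t'; rewrite /ev tlift_linear. Qed.

HB.instance Definition _ P Q :=
  GRing.isLinear.Build k (tensor g g) k *%R (ev P Q) (ev_is_scalar P Q).

Lemma ev_tens P Q x y :
  ev P Q (tens x y) = \tr (P *m vsval x) * \tr (Q *m vsval y).
Proof.
have trP R c (u v : g) : \tr (R *m vsval (c *: u + v))
    = c * \tr (R *m vsval u) + \tr (R *m vsval v).
  have -> : vsval (c *: u + v) = c *: vsval u + vsval v by rewrite linearP.
  by rewrite mulmxDr -scalemxAr mxtraceD mxtraceZ.
rewrite /ev tlift_tens // => [w|v] c u v' /=.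
  by rewrite trP mulrDl -mulrA.
by rewrite trP mulrDr mulrCA.
Qed.

Lemma evDl P P' Q t : ev (P + P') Q t = ev P Q t + ev P' Q t.
Proof. by rewrite !ev_contl mulmxDl mxtraceD. Qed.
Lemma evZl c P Q t : ev (c *: P) Q t = c * ev P Q t.
Proof. by rewrite !ev_contl -scalemxAl mxtraceZ. Qed.
Lemma evDr P Q Q' t : ev P (Q + Q') t = ev P Q t + ev P Q' t.
Proof. by rewrite !ev_contr mulmxDl mxtraceD. Qed.
Lemma evZr c P Q t : ev P (c *: Q) t = c * ev P Q t.
Proof. by rewrite !ev_contr -scalemxAl mxtraceZ. Qed.

Lemma ev_tlift P Q (b : g -> g -> tensor g g) t :
  ev P Q (tlift b t) = @tlift k g g k^o (fun x y => ev P Q (b x y)) t.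
Proof.
rewrite /tlift /tlift_semi linear_sum; apply: eq_bigr => i _.
by rewrite linear_sum; apply: eq_bigr => l _; rewrite linearZ.
Qed.

Lemma ev_tflip P Q t : ev P Q (tflip t) = ev Q P t.
Proof.
rewrite ev_tlift; apply: (@eq_tlift _ _ _ k^o) => x y.
by rewrite ev_tens mulrC.
Qed.

Lemma ev_tmap P Q (f h : g -> g) t :
  ev P Q (tmap f h t) =
  @tlift k g g k^o (fun x y => \tr (P *m vsval (f x)) * \tr (Q *m vsval (h y))) t.
Proof.
rewrite ev_tlift; apply: (@eq_tlift _ _ _ k^o) => x y.
exact: ev_tens.
Qed.

Lemma tmapZ (f h : g -> g) c t : tmap f h (c *: t) = c *: tmap f h t.
Proof. by have := tlift_linear (fun x y => tens (f x) (h y)) c t 0; rewrite addr0 tlift0 addr0. Qed.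

Lemma tmapD (f h : g -> g) t t' : tmap f h (t + t') = tmap f h t + tmap f h t'.
Proof. by have := tlift_linear (fun x y => tens (f x) (h y)) 1 t t'; rewrite !scale1r. Qed.

Lemma ev_Ad X P Q t : X \in unitmx ->
  ev P Q (tmap (Ad X) (Ad X) t) =
  ev (invmx X *m P *m X) (invmx X *m Q *m X) t.
Proof.
move=> uX; rewrite ev_tmap; apply: (@eq_tlift _ _ _ k^o) => x y /=.
by rewrite !AdE // !mulmxA !(mxtrace_mulC _ (invmx X)) !mulmxA.
Qed.

Lemma contr_Ad X P t : X \in unitmx ->
  contr P (tmap (Ad X) (Ad X) t) = X *m contr (invmx X *m P *m X) t *m invmx X.
Proof.
move=> uX; apply: mxtrace_mulP => Q; rewrite -ev_contr ev_Ad // ev_contr.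
by rewrite !mulmxA [RHS]mxtrace_mulC !mulmxA.
Qed.

(** Cyclicity of the trace moves the brackets from the legs of r onto the test matrices, so that
    ad-invariance of r becomes invariance of a bilinear form on gl(n). *)
Lemma ev_coboundary P Q r a :
  ev P Q (coboundary (@sl_bracket k n) r a) =
  ev (vsval a *m P - P *m vsval a) Q r + ev P (vsval a *m Q - Q *m vsval a) r.
Proof.
have tr_br R x : \tr (R *m vsval (sl_bracket x a))
    = \tr ((vsval a *m R - R *m vsval a) *m vsval x).
  rewrite sl_bracketE mulmxBl mulmxBr !mulmxA !linearB /=.
  by rewrite -!mulmxA [in LHS]mulmxA [in LHS]mxtrace_mulC.
rewrite linearD /= !ev_tmap; congr (_ + _); apply: (@eq_tlift _ _ _ k^o) => x y;
  by rewrite tr_br.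
Qed.

Lemma coboundaryZ c r a :
  coboundary (@sl_bracket k n) (c *: r) a = c *: coboundary (@sl_bracket k n) r a.
Proof. by rewrite /coboundary !tmapZ scalerDr. Qed.

Lemma coboundaryD r r' a :
  coboundary (@sl_bracket k n) (r + r') a =
  coboundary (@sl_bracket k n) r a + coboundary (@sl_bracket k n) r' a.
Proof. by rewrite /coboundary !tmapD addrACA. Qed.

Lemma bilin_delta_eq (B B' : 'M[k]_n -> 'M[k]_n -> k) :
  (forall P, scalar (B P)) -> (forall Q, scalar (B^~ Q)) ->
  (forall P, scalar (B' P)) -> (forall Q, scalar (B'^~ Q)) ->
  (forall i l i' l', B (delta_mx i l) (delta_mx i' l')
     = B' (delta_mx i l) (delta_mx i' l')) ->
  forall P Q, B P Q = B' P Q.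
Proof.
move=> Br Bl B'r B'l eqB P Q.
have lin (h h' : 'M[k]_n -> k) : scalar h -> scalar h' ->
    (forall i l, h (delta_mx i l) = h' (delta_mx i l)) -> forall M, h M = h' M.
  move=> lh lh' eqh M.
  pose H := HB.pack_for {scalar 'M[k]_n} h (GRing.isLinear.Build _ _ _ _ h lh).
  pose H' := HB.pack_for {scalar 'M[k]_n} h' (GRing.isLinear.Build _ _ _ _ h' lh').
  rewrite [M]matrix_sum_delta -[LHS]/(H _) -[RHS]/(H' _) !linear_sum.
  apply: eq_bigr => i _; rewrite !linear_sum; apply: eq_bigr => l _.
  by rewrite !linearZ /= eqh.
apply: (lin (B P) (B' P)) => // i' l'.
by apply: (lin (B^~ _) (B'^~ _)) => // i l.
Qed.

Lemma ev_scalarl t Q : scalar ((ev^~ Q)^~ t).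
Proof. by move=> c P P'; rewrite evDl evZl. Qed.
Lemma ev_scalarr t P : scalar ((ev P)^~ t).
Proof. by move=> c Q Q'; rewrite evDr evZr. Qed.

End BilinearForm.

(** * Symmetry of ad-invariant bilinear forms on gl(n) *)

Section InvariantForm.
Variables (k : fieldType) (n : nat).
Hypothesis two_neq0 : 2%:R != 0 :> k.

Lemma mulmx_delta (p q a b : 'I_n) :
  delta_mx p q *m delta_mx a b = (q == a)%:R *: delta_mx p b :> 'M[k]_n.
Proof.
case: eqVneq => [->|nqa]; first by rewrite mul_delta_mx scale1r.
by rewrite mul_delta_mx_0 // scale0r.
Qed.

Variable B : 'M[k]_n -> 'M[k]_n -> k.
Hypotheses (B_linr : forall P, scalar (B P)) (B_linl : forall Q, scalar (B^~ Q)).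
Hypothesis B_inv : forall A P Q,
  B (A *m P - P *m A) Q + B P (A *m Q - Q *m A) = 0.

Let b4 a b c d := B (delta_mx a b) (delta_mx c d).

Let B_inv4 (p q a b c d : 'I_n) :
  (q == a)%:R * b4 p b c d - (b == p)%:R * b4 a q c d
  + ((q == c)%:R * b4 a b p d - (d == p)%:R * b4 a b c q) = 0.
Proof.
have lin2 (h : 'M[k]_n -> k) x y Q Q' : scalar h ->
    h (x *: Q - y *: Q') = x * h Q - y * h Q'.
  move=> lh.
  pose H := HB.pack_for {scalar 'M[k]_n} h (GRing.isLinear.Build _ _ _ _ h lh).
  by rewrite -[LHS]/(H _) linearB !linearZ.
have := B_inv (delta_mx p q) (delta_mx a b) (delta_mx c d).
by rewrite !mulmx_delta lin2 // (lin2 (B^~ _)).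
Qed.

Let weight (p a b c d : 'I_n) :
  ((p == a)%:R - (b == p)%:R + ((p == c)%:R - (d == p)%:R)) * b4 a b c d = 0.
Proof.
have := B_inv4 p p a b c d; rewrite /b4.
case: (eqVneq p a) => [<-|_]; case: (eqVneq b p) => [->|_];
case: (eqVneq p c) => [<-|_]; case: (eqVneq d p) => [->|_];
by rewrite /= ?mulr1n ?mulr0n => H; rewrite -[RHS]H; ring.
Qed.

(** Invariance under the diagonal matrix units forces the weight eps_a - eps_b + eps_c - eps_d to
    vanish in k. As 2 is invertible, the lower indices must then cancel the upper ones in pairs. *)
Let b4_supp a b c d : b4 a b c d != 0 ->
  (b == a) && (d == c) || (d == a) && (b == c).
Proof.
move=> nz.
have w p : ((p == a)%:R - (b == p)%:R + ((p == c)%:R - (d == p)%:R)) = 0 :> k.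
  by apply/eqP; have /eqP := weight p a b c d; rewrite mulf_eq0 (negPf nz) orbF.
have [ba|nba] /= := eqVneq b a.
  have := w c; rewrite ba eqxx (eq_sym a c) subrr add0r.
  by case: (eqVneq d c) => //= _ /eqP; rewrite subr0 oner_eq0.
have := w b; rewrite (negPf nba) eqxx sub0r.
have [ebc _|nbc] := eqVneq b c.
  have := w a; rewrite eqxx (negPf nba) subr0 -ebc (eq_sym a b) (negPf nba) sub0r.
  by case: (eqVneq d a) => //= _ /eqP; rewrite oppr0 addr0 oner_eq0.
have [_|_] /= := eqVneq d b.
  by rewrite mulr1n mulr0n sub0r -opprD => /eqP; rewrite oppr_eq0 -(natrD _ 1 1) (negPf two_neq0).
by rewrite subr0 addr0 => /eqP; rewrite oppr_eq0 oner_eq0.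
Qed.

(** Four instances of invariance under E_pq, applied to pairs formed by E_qp and a diagonal unit,
    are linear relations; suitable combinations read 2 (x - y) = 0. *)
Let b4_swap p q : p != q ->
  b4 p p q q = b4 q q p p /\ b4 p q q p = b4 q p p q.
Proof.
move=> npq; have nqp : q != p by rewrite eq_sym.
have := B_inv4 p q p p q p; have := B_inv4 p q q p p p.
have := B_inv4 p q q p q q; have := B_inv4 p q q q q p.
rewrite !eqxx !(negPf nqp) /= !mulr0n !mulr1n !mul0r !mul1r => e1 e2 e3 e4.
have half x y : 2%:R * (x - y) = 0 -> x = y :> k.
  by move/eqP; rewrite mulf_eq0 (negPf two_neq0) subr_eq0 => /eqP.
split; apply: half.
  transitivity ((b4 p p p p - b4 q q p p + (0 - b4 q p p q)
    - (0 - b4 p q q p + (b4 p p p p - b4 p p q q)))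
    - ((b4 p q q p - 0 + (b4 q q p p - b4 q q q q))
    - (b4 p p q q - b4 q q q q + (b4 q p p q - 0)))); first by ring.
  by rewrite e1 e2 e3 e4 !subrr.
transitivity ((b4 p p p p - b4 q q p p + (0 - b4 q p p q)
    - (0 - b4 p q q p + (b4 p p p p - b4 p p q q)))
    + ((b4 p q q p - 0 + (b4 q q p p - b4 q q q q))
    - (b4 p p q q - b4 q q q q + (b4 q p p q - 0)))); first by ring.
by rewrite e1 e2 e3 e4 !subrr addr0.
Qed.

Lemma invariant_form_sym a b c d :
  B (delta_mx a b) (delta_mx c d) = B (delta_mx c d) (delta_mx a b).
Proof.
have sym0 a' b' c' d' : b4 a' b' c' d' != 0 -> b4 a' b' c' d' = b4 c' d' a' b'.
  case/b4_supp/orP => /andP[/eqP-> /eqP->].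
    by have [->//|/b4_swap[]] := eqVneq a' c'.
  by have [->//|/b4_swap[]] := eqVneq a' c'.
rewrite -!/(b4 _ _ _ _).
have [z1|/sym0//] := eqVneq (b4 a b c d) 0.
have [z2|/sym0//] := eqVneq (b4 c d a b) 0.
by rewrite z1 z2.
Qed.

End InvariantForm.

(** * The Casimir element and the symmetric part of r_BD *)

Section Casimir.
Variables (k : fieldType) (n : nat).
Hypothesis n_neq0 : n%:R != 0 :> k.
Notation g := (subvs_of (sl k n)).
Implicit Types (P Q A X : 'M[k]_n) (x y a : g) (t r : tensor g g).

(** Pairing with sl sees a matrix only modulo scalars, and n being invertible gives a representative
    in sl. This is the source of the term - tr P tr Q / n below. *)
Let traceless P : g := vsproj (sl k n) (P - (\tr P / n%:R)%:M).

Let tracelessE P : vsval (traceless P) = P - (\tr P / n%:R)%:M.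
Proof.
by rewrite vsprojK // mem_sl linearB /= mxtrace_scalar -[X in _ - X]mulr_natr divfK // subrr.
Qed.

Let tr_sl x : \tr (vsval x) = 0.
Proof. by apply/eqP; rewrite -mem_sl subvsP. Qed.

Let tr_traceless P x : \tr (vsval (traceless P) *m vsval x) = \tr (P *m vsval x).
Proof.
by rewrite tracelessE mulmxBl mul_scalar_mx linearB /= mxtraceZ tr_sl mulr0 subr0.
Qed.

Let vsval_coord x :
  vsval x = \sum_i coord (vbasis {:g}) i x *: vsval (vbasis {:g})`_i.
Proof.
by rewrite {1}(coord_vbasis (memvf x)) linear_sum; apply: eq_bigr => i _; rewrite linearZ.
Qed.

Let gram : 'M[k]_(\dim {:g}) :=
  \matrix_(i, j) \tr (vsval (vbasis {:g})`_i *m vsval (vbasis {:g})`_j).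

Let tr_coord P (j : 'I_(\dim {:g})) :
  \tr (P *m vsval (vbasis {:g})`_j)
    = ((\row_i coord (vbasis {:g}) i (traceless P)) *m gram) 0 j.
Proof.
rewrite -tr_traceless (vsval_coord (traceless P)).
rewrite mulmx_suml linear_sum mxE /=; apply: eq_bigr => i _.
by rewrite -scalemxAl mxtraceZ !mxE.
Qed.

(** The trace form is nondegenerate on sl: a kernel vector of [gram] is an element of sl orthogonal
    to sl, hence to all matrices, hence zero. *)
Lemma gram_unit : gram \in unitmx.
Proof.
rewrite -row_free_unit -kermx_eq0; apply/eqP/row_matrixP => i; rewrite row0.
have: row i (kermx gram) *m gram = 0 by rewrite -row_mul mulmx_ker row0.
move: (row i _) => v vG.
pose y : g := \sum_l v 0 l *: (vbasis {:g})`_l.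
have y0 : vsval y = 0.
  apply: mxtrace_mulP => Q; rewrite mulmx0 mxtrace0 -tr_traceless mxtrace_mulC.
  rewrite (vsval_coord (traceless Q)) mulmx_sumr linear_sum /=.
  apply: big1 => j _; rewrite -scalemxAr mxtraceZ.
  suff -> : \tr (vsval y *m vsval (vbasis {:g})`_j) = (v *m gram) 0 j.
    by rewrite vG mxE mulr0.
  rewrite /y linear_sum /= mulmx_suml linear_sum mxE /=; apply: eq_bigr => l _.
  by rewrite -scalemxAl mxtraceZ !mxE.
apply/rowP => l; rewrite mxE.
have: y = 0 by apply: val_inj.
move/(congr1 (coord (vbasis {:g}) l)).
by rewrite coord_sum_free ?(basis_free (vbasisP _)) // linear0.
Qed.

Lemma ev_casimir P Q :
  ev P Q (casimir k n) = \tr (P *m Q) - \tr P * \tr Q / n%:R.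
Proof.
pose c := \row_i coord (vbasis {:g}) i (traceless P).
(* The row c *m gram lists the traces of P against the basis, so [invmx gram], which is the Casimir
   element, brings it back to the coordinates of the traceless part of P. *)
have -> : ev P Q (casimir k n) =
    (c *m gram *m invmx gram *m (\col_j \tr (Q *m vsval (vbasis {:g})`_j))) 0 0.
  rewrite -mulmxA mxE /ev /tlift /tlift_semi; apply: eq_bigr => i _.
  rewrite -tr_coord mxE mulr_sumr; apply: eq_bigr => l _.
  by rewrite mxE -[LHS]/(_ * (_ * _)) mulrCA.
rewrite mulmxK ?gram_unit // mxE.
transitivity (\tr (Q *m vsval (traceless P))).
  rewrite (vsval_coord (traceless P)) mulmx_sumr linear_sum /=.
  by apply: eq_bigr => i _; rewrite !mxE -scalemxAr mxtraceZ.
rewrite tracelessE mulmxBr linearB /= mxtrace_mulC; congr (_ - _).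
by rewrite mul_mx_scalar mxtraceZ mulrAC.
Qed.

Lemma ev_casimir0 P Q :
  ev P Q (casimir0 k n) =
    \sum_i P i i * Q i i - \tr P * \tr Q / n%:R.
Proof.
pose D P : 'M[k]_n := diag_mx (\row_i P i i).
have trD R x : \tr (R *m vsval (cartan_proj x)) = \tr (D R *m vsval x).
  rewrite cartan_projE /D mul_mx_diag mul_diag_mx /mxtrace.
  by apply: eq_bigr => i _; rewrite !mxE.
have trDE R : \tr (D R) = \tr R.
  by rewrite mxtrace_diag; apply: eq_bigr => i _; rewrite mxE.
rewrite ev_tmap; transitivity (ev (D P) (D Q) (casimir k n)).
  by apply: (@eq_tlift _ _ _ k^o) => x y; rewrite !trD.
rewrite ev_casimir !trDE; congr (_ - _).
by rewrite mul_diag_mx /mxtrace; apply: eq_bigr => i _; rewrite !mxE eqxx.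
Qed.

Lemma ev_twedge_sym P Q x y : ev P Q (twedge x y) + ev Q P (twedge x y) = 0.
Proof.
rewrite !linearB /= !ev_tens.
by rewrite addrC -opprB addrC [X in X - _]addrC; ring.
Qed.

Lemma tr_root_vec P (a : 'I_n * 'I_n) : a.1 != a.2 ->
  \tr (P *m vsval (root_vec k a)) = P a.2 a.1.
Proof.
move=> na; rewrite root_vecE // mxtrace_mulC /mxtrace (bigD1 a.1) //= big1 => [|l nl].
  rewrite mxE (bigD1 a.2) //= big1 => [|l nl].
    by rewrite mxE !eqxx mul1r !addr0.
  by rewrite mxE (negPf nl) andbF mul0r.
by rewrite mxE big1 // => l' _; rewrite mxE (negPf nl) mul0r.
Qed.

(** This is r + r^21 = Omega: r0 contributes the Cartan part, the wedges cancel, and the terms e_a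
    (x) e_(-a) with their flips supply the off-diagonal part of tr(P Q). *)
Lemma ev_bd_sym G1 G2 (tau : 'I_n * 'I_n -> 'I_n * 'I_n) r P Q :
  is_bd_rmatrix G1 G2 tau r ->
  ev P Q r + ev Q P r = \tr (P *m Q) - \tr P * \tr Q / n%:R.
Proof.
move=> [r0 [theta [[_ r0sym _] _ ->]]].
have pos_neq (a : 'I_n * 'I_n) : positive a -> a.1 != a.2.
  by rewrite /positive; apply: contraTneq => ->; rewrite ltnn.
have e0 : ev P Q r0 + ev Q P r0 = \sum_i P i i * Q i i - \tr P * \tr Q / n%:R.
  by rewrite -ev_casimir0 -r0sym linearD /= ev_tflip.
rewrite !linearD /=.
set s1 := \sum_(a | _) tens _ _; set s2 := \sum_(a | _) _.
have e2 : ev P Q s2 + ev Q P s2 = 0.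
  rewrite !linear_sum -big_split; apply: big1 => a _ /=.
  rewrite !linear_sum -big_split; apply: big1 => m _ /=.
  exact: ev_twedge_sym.
have e1 : ev P Q s1 + ev Q P s1 =
    \sum_(a | positive a) P a.2 a.1 * Q a.1 a.2
    + \sum_(a | positive a) Q a.2 a.1 * P a.1 a.2.
  rewrite !linear_sum; congr (_ + _); apply: eq_bigr => a /pos_neq na /=;
    by rewrite ev_tens !tr_root_vec // eq_sym.
rewrite addrACA e0 [X in _ + X]addrACA e1 e2 addr0 addrAC; congr (_ - _).
have -> : \tr (P *m Q) = \sum_(a : 'I_n * 'I_n) P a.1 a.2 * Q a.2 a.1.
  by rewrite /mxtrace; under eq_bigr do rewrite mxE; rewrite pair_bigA.
rewrite [RHS](bigID (fun a : 'I_n * 'I_n => a.1 == a.2)) /=; congr (_ + _).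
  rewrite -(pair_big_dep xpredT (fun i j => i == j) (fun i j => P i j * Q j i)) /=.
  by apply: eq_bigr => i _; rewrite (big_pred1 i) // => j; rewrite eq_sym.
rewrite [RHS](bigID (@positive n)) /= [LHS]addrC; congr (_ + _).
  apply: eq_big => [a|a _]; last exact: mulrC.
  by rewrite /positive -val_eqE /= neq_ltn; case: ltngtP.
rewrite (reindex_inj (inv_inj (_ : involutive (@oppr_root n)))) => [|[] //].
apply: eq_bigl => a; rewrite /positive /=.
by rewrite -val_eqE /=; case: ltngtP.
Qed.
End Casimir.

(** * The conjugate-transpose twist *)

Section Twist.
Variables (k : fieldType) (n : nat) (gam : {rmorphism k -> k}).
Notation g := (subvs_of (sl k n)).
Implicit Types (P Q A X : 'M[k]_n) (x y a : g) (t r s : tensor g g).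

Lemma trmx_scale c P : (c *: P)^T = c *: P^T.
Proof. exact: linearZ. Qed.

Definition theta x : g := vsproj (sl k n) (- (map_mx gam (vsval x))^T).

Lemma thetaE x : vsval (theta x) = - (map_mx gam (vsval x))^T.
Proof.
rewrite vsprojK // mem_sl linearN /= mxtrace_tr trace_map_mx oppr_eq0 fmorph_eq0.
by rewrite -mem_sl subvsP.
Qed.

Lemma theta_semilinear c x y : theta (c *: x + y) = gam c *: theta x + theta y.
Proof.
have vsvalP b u v : vsval (b *: u + v : g) = b *: vsval u + vsval v.
  exact: linearP.
apply: subvs_inj; rewrite vsvalP !thetaE vsvalP; apply/matrixP => i j.
by rewrite !mxE rmorphD rmorphM opprD mulrN.
Qed.

Lemma theta_bracket x a : theta (sl_bracket x a) = sl_bracket (theta x) (theta a).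
Proof.
apply: subvs_inj; rewrite !(thetaE, sl_bracketE).
rewrite map_mxB !map_mxM linearB /= !trmx_mul opprB !mulNmx !mulmxN !opprK.
by [].
Qed.

Lemma tens_linearl (y : g) : linear ((@tens k g g)^~ y).
Proof.
move=> c u v; apply/matrixP => i j.
by rewrite !mxE linearP /= mulrDl mulrA.
Qed.

Lemma tens_linearr (x : g) : linear (@tens k g g x).
Proof.
move=> c u v; apply/matrixP => i j.
by rewrite !mxE linearP /= mulrDr mulrCA.
Qed.

Definition tw t : tensor g g :=
  tlift_semi gam (fun x y => tens (theta x) (theta y)) t.

Lemma tw_tens x y : tw (tens x y) = tens (theta x) (theta y).
Proof.
rewrite /tw tlift_semi_tens // => *; rewrite theta_semilinear.
  exact: tens_linearl.
exact: tens_linearr.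
Qed.

Lemma twD t t' : tw (t + t') = tw t + tw t'. Proof. exact: tlift_semiD. Qed.
Lemma twZ c t : tw (c *: t) = gam c *: tw t. Proof. exact: tlift_semiZ. Qed.

Lemma tw0 : tw 0 = 0. Proof. by have := twZ 0 0; rewrite rmorph0 !scale0r. Qed.

Lemma tw_sum (I : Type) (rs : seq I) (F : I -> tensor g g) :
  tw (\sum_(i <- rs) F i) = \sum_(i <- rs) tw (F i).
Proof. by elim: rs => [|i rs IH]; rewrite ?(big_nil, tw0) // !big_cons twD IH. Qed.

Lemma tmap_sum (f h : g -> g) (I : Type) (rs : seq I) (F : I -> tensor g g) :
  tmap f h (\sum_(i <- rs) F i) = \sum_(i <- rs) tmap f h (F i).
Proof.
elim: rs => [|i rs IH]; first by rewrite !big_nil /tmap tlift0.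
by rewrite !big_cons tmapD IH.
Qed.

Lemma tw_tmap (f h f' h' : g -> g) t : linear f' -> linear h' ->
  (forall x, theta (f x) = f' (theta x)) -> (forall x, theta (h x) = h' (theta x)) ->
  tw (tmap f h t) = tmap f' h' (tw t).
Proof.
move=> lf lh ff hh; rewrite {1}/tmap /tlift /tlift_semi tw_sum.
rewrite [in RHS]/tw /tlift_semi tmap_sum; apply: eq_bigr => i _.
rewrite tw_sum tmap_sum; apply: eq_bigr => l _.
rewrite twZ tmapZ tw_tens ff hh; congr (_ *: _).
rewrite /tmap tlift_tens // => [w|v] c u u'.
  by rewrite lf; exact: tens_linearl.
by rewrite lh; exact: tens_linearr.
Qed.

Lemma tw_coboundary r a :
  tw (coboundary (@sl_bracket k n) r a)
    = coboundary (@sl_bracket k n) (tw r) (theta a).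
Proof.
have lb : linear ((@sl_bracket k n)^~ (theta a)).
  move=> c u v; apply: subvs_inj; rewrite !linearP /= !sl_bracketE linearP /=.
  by rewrite mulmxDl mulmxDr -scalemxAl -scalemxAr scalerBr opprD addrACA.
rewrite /coboundary twD; congr (_ + _); apply: tw_tmap => // x; exact: theta_bracket.
Qed.

(** From tr(gam(P) theta(x)) = - gam(tr(P^T x)); the two signs, one per leg, cancel. Since [gam] is
    only an endomorphism, the left test matrix is taken in its image. *)
Lemma ev_tw P Q t :
  ev (map_mx gam P) Q (tw t) = \tr (Q *m (map_mx gam (contr P^T t))^T).
Proof.
have trl x : \tr (map_mx gam P *m vsval (theta x)) = - gam (\tr (P^T *m vsval x)).
  rewrite thetaE mulmxN linearN /= -trace_map_mx map_mxM; congr (- _).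
  by rewrite -mxtrace_tr trmx_mul trmxK mxtrace_mulC map_trmx.
rewrite /tw /contr /tlift /tlift_semi linear_sum raddf_sum linear_sum /=.
rewrite mulmx_sumr linear_sum; apply: eq_bigr => i _ /=.
rewrite linear_sum raddf_sum linear_sum /= mulmx_sumr linear_sum; apply: eq_bigr => l _ /=.
rewrite linearZ /= ev_tens trl thetaE !map_mxZ !trmx_scale -!scalemxAr !mxtraceZ.
by rewrite mulmxN linearN /= mulrNN.
Qed.

Lemma ev_tw2 P Q t :
  ev (map_mx gam P) (map_mx gam Q) (tw t) = gam (ev P^T Q^T t).
Proof.
rewrite ev_tw ev_contr -trace_map_mx map_mxM -mxtrace_tr trmx_mul trmxK.
by rewrite mxtrace_mulC map_trmx.
Qed.

Hypothesis two_neq0 : 2%:R != 0 :> k.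

(** Invariance makes s + tw s symmetric, that is s - s^21 = (tw s)^21 - tw s, while tw fixes the
    Casimir element, so s + s^21 = tw s + (tw s)^21. Subtracting gives 2 tw s = 2 s^21. It is enough
    to test on matrix units, which [gam] fixes. *)
Lemma tw_flip s :
  (forall P Q, ev P Q s + ev Q P s = \tr (P *m Q) - \tr P * \tr Q / n%:R) ->
  (forall A P Q, ev (A *m P - P *m A) Q (s + tw s)
     + ev P (A *m Q - Q *m A) (s + tw s) = 0) ->
  forall P Q, ev P Q (tw s) = ev Q P s.
Proof.
move=> sym inv; apply: bilin_delta_eq.
- by move=> P; apply: ev_scalarr.
- by move=> Q; apply: ev_scalarl.
- by move=> P; apply: ev_scalarl.
- by move=> Q; apply: ev_scalarr.
move=> p q p' q'; set P := delta_mx p q; set Q := delta_mx p' q'.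
have e1 : ev P Q (s + tw s) = ev Q P (s + tw s).
  apply: (invariant_form_sym two_neq0 (B := fun P Q => ev P Q (s + tw s))) => //.
  - by move=> P'; apply: ev_scalarr.
  - by move=> Q'; apply: ev_scalarl.
have gP : map_mx gam P = P by rewrite map_delta_mx.
have gQ : map_mx gam Q = Q by rewrite map_delta_mx.
have e2 : ev P Q (tw s) + ev Q P (tw s) = ev P Q s + ev Q P s.
  rewrite -{1 2}gP -{1 2}gQ !ev_tw2 -rmorphD sym sym.
  rewrite rmorphB !rmorphM fmorphV rmorph_nat -!trace_map_mx map_mxM -!map_trmx gP gQ.
  by rewrite !mxtrace_tr -trmx_mul mxtrace_tr [\tr (Q *m P)]mxtrace_mulC.
apply/eqP; rewrite -subr_eq0 -(mulrI_eq0 _ (mulfI two_neq0)); apply/eqP.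
rewrite !linearD /= in e1.
transitivity ((ev P Q (tw s) + ev Q P (tw s) - (ev P Q s + ev Q P s))
  + (ev P Q s + ev P Q (tw s) - (ev Q P s + ev Q P (tw s)))); first by ring.
by rewrite e2 e1 !subrr addr0.
Qed.

End Twist.

(** * The unitary form inside sl(n, Fbar) *)

Section UnitaryForm.
Variables (F : fieldType) (K : splittingFieldType F) (n : nat).
Variables (sigma : gal_of {:K}) (L : fieldType) (j : {rmorphism K -> L}).
Variable gam : {rmorphism L -> L}.
Hypothesis gam_j : forall c, gam (j c) = j (sigma c).
Notation g := (subvs_of (sl L n)).
Notation u := (subvs_of (su n sigma)).

Lemma gal_alg (c : F) : sigma c%:A = c%:A.
Proof. by rewrite linearZ /= rmorph1. Qed.

Lemma theta_su (x : u) : theta gam (su_to_sl j x) = su_to_sl j x.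
Proof.
apply: subvs_inj; rewrite thetaE !su_to_slE; apply/matrixP => p q.
have := subvsP x; rewrite mem_su => /andP[_ /eqP/matrixP/(_ p q)].
rewrite !mxE => /eqP; rewrite addrC addr_eq0 => /eqP->.
by rewrite gam_j rmorphN.
Qed.

Lemma tw_su (t : tensor u u) :
  let t' := tlift_semi (fun c : F => j c%:A)
      (fun x y => tens (su_to_sl j x) (su_to_sl j y)) t in
  tw gam t' = t'.
Proof.
rewrite /= /tlift_semi tw_sum; apply: eq_bigr => i _.
rewrite tw_sum; apply: eq_bigr => l _.
by rewrite twZ tw_tens !theta_su gam_j gal_alg.
Qed.

Variable sqrtd : K.
Hypotheses (sqrtd_neq0 : sqrtd != 0) (gal_sqrtd : sigma sqrtd = - sqrtd).
Hypotheses (two_neq0 : 2%:R != 0 :> K) (n_neq0 : n%:R != 0 :> K).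

Definition ad_invariant (r : tensor g g) (A : 'M[L]_n) := forall P Q,
  ev (A *m P - P *m A) Q r + ev P (A *m Q - Q *m A) r = 0.

Lemma ad_invariantP r c A A' : ad_invariant r A -> ad_invariant r A' ->
  ad_invariant r (c *: A + A').
Proof.
move=> iA iA' P Q.
have comm M : (c *: A + A') *m M - M *m (c *: A + A')
    = c *: (A *m M - M *m A) + (A' *m M - M *m A').
  by rewrite mulmxDl mulmxDr -scalemxAl -scalemxAr scalerBr opprD addrACA.
rewrite !comm evDl evDr evZl evZr addrACA -mulrDr iA iA'.
by rewrite mulr0 addr0.
Qed.

Lemma ad_invariant_scalar r c : ad_invariant r c%:M.
Proof.
move=> P Q; rewrite !mul_scalar_mx !mul_mx_scalar !subrr.
have ev0 : ev 0 Q r = 0 by rewrite -(scale0r 0) evZl mul0r.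
by rewrite ev0 add0r -(scale0r 0) evZr mul0r.
Qed.

(** Together with the scalar matrices, su spans gl(n) over Fbar, and the matrices leaving r
    invariant form a subspace containing the scalars. *)
Lemma ad_invariant_su r :
  (forall x : u, coboundary (@sl_bracket L n) r (su_to_sl j x) = 0) ->
  forall A, ad_invariant r A.
Proof.
move=> cob0.
have inv_su (B : 'M[K]_n) : \tr B = 0 -> (map_mx sigma B)^T + B = 0 ->
    ad_invariant r (map_mx j B).
  move=> trB skB P Q.
  have suB : (B : mx_over K n) \in su n sigma by rewrite mem_su trB skB !eqxx.
  have := ev_coboundary P Q r (su_to_sl j (Subvs suB)).
  by rewrite cob0 linear0 su_to_slE => /esym.
have sigma_delta p q : map_mx sigma (delta_mx p q : 'M[K]_n) = delta_mx p q.
  exact: map_delta_mx.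
have inv_delta p q : ad_invariant r (delta_mx p q).
  pose D : 'M[K]_n := delta_mx p q.
  pose D0 := D - (\tr D / n%:R)%:M.
  (* D0 has entries fixed by [sigma], so its antisymmetric part is in su, and so is its symmetric
     part divided by sqrt d, as [sigma] negates sqrt d. Hence D0 = A1 + sqrt d A2. *)
  pose A1 := 2%:R^-1 *: (D0 - D0^T).
  pose A2 := (2%:R * sqrtd)^-1 *: (D0 + D0^T).
  have trD0 : \tr D0 = 0.
    by rewrite linearB /= mxtrace_scalar -[X in _ - X]mulr_natr divfK // subrr.
  have sD0 : map_mx sigma D0 = D0.
    rewrite map_mxB map_scalar_mx sigma_delta rmorphM fmorphV rmorph_nat /=.
    by rewrite -trace_map_mx sigma_delta.
  have i1 : ad_invariant r (map_mx j A1).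
    apply: inv_su; first by rewrite linearZ linearB /= mxtrace_tr subrr mulr0.
    rewrite map_mxZ map_mxB -map_trmx sD0 fmorphV rmorph_nat trmx_scale linearB /= trmxK.
    by rewrite -scalerDr addrC addrA subrK subrr scaler0.
  have i2 : ad_invariant r (map_mx j A2).
    apply: inv_su; first by rewrite linearZ linearD /= mxtrace_tr trD0 addr0 mulr0.
    rewrite map_mxZ map_mxD -map_trmx sD0 fmorphV rmorphM rmorph_nat /= gal_sqrtd.
    rewrite trmx_scale linearD /= trmxK mulrN invrN scaleNr [D0^T + _]addrC.
    by rewrite addNr.
  have -> : delta_mx p q = j sqrtd *: map_mx j A2
      + (1 *: map_mx j A1 + (j (\tr D / n%:R))%:M).
    rewrite scale1r -map_mxZ -map_scalar_mx -!map_mxD /A2 /A1.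
    rewrite -(map_delta_mx j); congr (map_mx j _).
    rewrite scalerA invfM mulrCA divff // mulr1 addrA -scalerDr.
    have -> : D0 + D0^T + (D0 - D0^T) = 2%:R *: D0.
      by rewrite addrACA subrr addr0 scaler_nat.
    by rewrite scalerA mulVf // scale1r /D0 subrK.
  apply: ad_invariantP => //; apply: ad_invariantP => //.
  exact: ad_invariant_scalar.
move=> A; rewrite [A]matrix_sum_delta.
have inv0 : ad_invariant r 0 by have := @ad_invariant_scalar r 0; rewrite raddf0.
have invD A1 A2 : ad_invariant r A1 -> ad_invariant r A2 -> ad_invariant r (A1 + A2).
  by move=> i1 i2; rewrite -[A1]scale1r; apply: ad_invariantP.
apply: big_ind => // p _; apply: big_ind => // q _.
by rewrite -[X in ad_invariant r X]addr0; apply: ad_invariantP.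
Qed.

(* deltaL commutes with the twist, which changes the sign of sqrtd.           *)
Lemma coboundary_twist (s : tensor g g)
    (delta : 'Hom(u, tensor u u)) (deltaL : 'Hom(g, tensor g g)) :
  is_scalar_extension j delta deltaL ->
  (forall a, deltaL a = coboundary (@sl_bracket L n) (j sqrtd *: s) a) ->
  forall A, ad_invariant (s + tw gam s) A.
Proof.
move=> ext cob; apply: ad_invariant_su => x.
have := tw_su (delta x); rewrite -ext cob /= tw_coboundary theta_su twZ.
rewrite gam_j gal_sqrtd rmorphN scaleNr !coboundaryZ.
rewrite -scaleN1r coboundaryZ scaleN1r => /eqP.
rewrite eq_sym -subr_eq0 opprK coboundaryZ -scalerDr -coboundaryD.
by rewrite scaler_eq0 fmorph_eq0 (negPf sqrtd_neq0) => /eqP.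
Qed.

End UnitaryForm.

(** * Belavin-Drinfeld triples and the supports of r-matrices *)

Section Triple.
Variables (n : nat) (G1 G2 : {set 'I_n * 'I_n}) (tau : 'I_n * 'I_n -> 'I_n * 'I_n).
Hypothesis triple : admissible_triple G1 G2 tau.
Implicit Types (a b c : 'I_n * 'I_n) (p q : 'I_n).

Lemma simpleP a : reflect (a.2 = a.1.+1 :> nat) (a \in simple_roots n).
Proof. by rewrite inE; apply: eqP. Qed.

Lemma simple_inj a b :
  a \in simple_roots n -> b \in simple_roots n -> a.1 = b.1 -> a = b.
Proof.
move=> /simpleP ea /simpleP eb eab; case: a b ea eb eab => [a1 a2] [b1 b2] /= ea eb eab.
by rewrite -eab; congr (_, _); apply: val_inj; rewrite /= ea eb eab.
Qed.

Lemma triple_simple a : a \in G1 -> a \in simple_roots n.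
Proof. by case: triple => /subsetP sub _ _ _ _ /sub. Qed.

Lemma triple_tau a : a \in G1 -> tau a \in G2.
Proof. by case: triple => _ _ [_ <-] _ _; apply: imset_f. Qed.

Lemma triple_simple2 a : a \in G2 -> a \in simple_roots n.
Proof. by case: triple => _ /subsetP sub _ _ _ /sub. Qed.

Lemma triple_inj : {in G1 &, injective tau}.
Proof. by case: triple => _ _ []. Qed.

(* The coefficient of v on the simple root (p, p + 1).                        *)
Definition psum p (v : 'rV[rat]_n) : rat := \sum_(q : 'I_n | (q <= p)%N) v 0 q.

Lemma psum_is_scalar p : scalar (psum p).
Proof.
move=> c u v; rewrite /psum mulr_sumr -big_split /=.
by apply: eq_bigr => q _; rewrite !mxE.
Qed.

HB.instance Definition _ p :=
  GRing.isLinear.Build rat 'rV[rat]_n rat *%R (psum p) (psum_is_scalar p).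

Lemma psum_root p a : psum p (root_row a) = (a.1 <= p)%N%:R - (a.2 <= p)%N%:R.
Proof.
have delta q : psum p (delta_mx 0 q) = (q <= p)%N%:R.
  rewrite /psum; under eq_bigr do rewrite mxE eqxx /=.
  rewrite big_mkcond (bigD1 q) //= big1 => [|q' nq].
    by rewrite eqxx addr0; case: (q <= p)%N.
  by rewrite (negPf nq) if_same.
by rewrite linearB /= !delta.
Qed.

Lemma psum_simple p a : a \in simple_roots n -> psum p (root_row a) = (a.1 == p)%:R.
Proof.
move=> /simpleP ea; rewrite psum_root ea -val_eqE /=.
by case: (ltngtP a.1 p) => _; rewrite ?subrr ?subr0.
Qed.

Let rows := image_tuple (@root_row n) G1.

Let nth_rows (i : 'I_#|G1|) : rows`_i = root_row (enum_val i).
Proof. exact: nth_image. Qed.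

Lemma root_row_free : free rows.
Proof.
apply/freeP => c /(congr1 (psum _)) c0 i.
move: (c0 (enum_val i).1); rewrite linear_sum linear0 (bigD1 i) //= big1 => [|l nl].
  rewrite nth_rows linearZ /= psum_simple ?eqxx ?mulr1 ?addr0 //.
  exact/triple_simple/enum_valP.
rewrite nth_rows linearZ /= psum_simple; last exact/triple_simple/enum_valP.
case: eqP => [e|_]; last by rewrite mulr0.
case/eqP: nl; apply: enum_val_inj; apply: simple_inj => //;
  exact/triple_simple/enum_valP.
Qed.

Lemma tau_ext_is_linear : linear (tau_ext G1 tau).
Proof.
move=> c u v; rewrite /tau_ext scaler_sumr -big_split /=.
by apply: eq_bigr => i _; rewrite linearP scalerDl scalerA.
Qed.

HB.instance Definition _ :=
  GRing.isLinear.Build rat 'rV[rat]_n 'rV[rat]_n *:%R (tau_ext G1 tau) tau_ext_is_linear.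

Lemma tau_ext_root a : a \in G1 -> tau_ext G1 tau (root_row a) = root_row (tau a).
Proof.
move=> Ga; have [i ->] : exists i : 'I_#|G1|, a = enum_val i.
  by exists (enum_rank_in Ga a); rewrite enum_rankK_in.
rewrite /tau_ext (bigD1 i) //= big1 => [|l nl].
  by rewrite -nth_rows coord_free ?root_row_free // eqxx scale1r addr0.
by rewrite -nth_rows coord_free ?root_row_free // eq_sym (negPf nl) scale0r.
Qed.

Lemma psum_span p v : v \in root_span G1 ->
  (forall a, a \in G1 -> a.1 != p) -> psum p v = 0.
Proof.
move=> vG nG; rewrite (coord_span vG) linear_sum big1 // => i _.
rewrite nth_rows linearZ /= psum_simple; last exact/triple_simple/enum_valP.
by rewrite (negPf (nG _ (enum_valP i))) mulr0.
Qed.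

(** The simple roots whose sum is the positive root a, see [root_row_sum]. Next, [chain] is the
    combinatorial counterpart of [tau_defined], read on these summands. *)
Definition summand a b : bool := (b \in simple_roots n) && (a.1 <= b.1 < a.2)%N.

Definition chain m a := forall b, summand a b -> forall l, (l < m)%N -> iter l tau b \in G1.

Lemma chainW m m' a : (m' <= m)%N -> chain m a -> chain m' a.
Proof. by move=> le ch b ub l lt; apply: ch => //; apply: leq_trans lt le. Qed.

Lemma chain_sub m a a' : (forall b, summand a' b -> summand a b) -> chain m a -> chain m a'.
Proof. by move=> sub ch b /sub; apply: ch. Qed.

Lemma iter_tau_simple m a b : chain m a -> summand a b -> iter m tau b \in simple_roots n.
Proof.
case: m => [|m] ch ub; first by case/andP: ub.
by rewrite iterS; apply/triple_simple2/triple_tau/ch.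
Qed.

Lemma simple_positive b : b \in simple_roots n -> positive b.
Proof. by move/simpleP; rewrite /positive => ->. Qed.

Lemma positive_ind (P : 'I_n * 'I_n -> Prop) :
  (forall b, b \in simple_roots n -> P b) ->
  (forall a b, positive a -> b \in simple_roots n -> a.2 = b.1 ->
     P a -> P (a.1, b.2)) ->
  forall a, positive a -> P a.
Proof.
move=> Psimple Pstep [p q]; rewrite /positive /=.
have [N ltqN] := ubnP (val q); elim: N => // N IHN in q ltqN *.
move=> ltpq; have [e|ne] := eqVneq (val q) p.+1; first by apply: Psimple; apply/simpleP.
have ltq' : (q.-1 < n)%N by apply: leq_ltn_trans (leq_pred _) (ltn_ord q).
have eq' : val q = (Ordinal ltq').+1 by rewrite /= prednK //; apply: leq_ltn_trans ltpq.
have lt' : (p < Ordinal ltq')%N by move: ltpq ne => /=; lia.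
apply: (Pstep (p, Ordinal ltq') (Ordinal ltq', q)) => //; first exact/simpleP.
by apply: IHN => //; rewrite -ltnS -eq'.
Qed.

Lemma summand_simple b c : b \in simple_roots n -> summand b c = (c == b).
Proof.
move=> sb; apply/andP/eqP => [[sc /andP[le lt]]|->]; last first.
  by rewrite sb leqnn; split=> //; exact: simple_positive sb.
apply: simple_inj => //; apply/val_inj/eqP; rewrite eqn_leq le andbT.
by move/simpleP: sb lt => ->.
Qed.

Lemma summand_cat a b c : positive a -> b \in simple_roots n -> a.2 = b.1 ->
  summand (a.1, b.2) c = summand a c || (c == b).
Proof.
move=> pa sb eab; rewrite -(summand_simple c sb) /summand /= eab.
case: (c \in simple_roots n) => //=; move/simpleP: sb => ->.
move: pa; rewrite /positive eab; lia.
Qed.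

Lemma root_row_sum a : positive a -> root_row a = \sum_(b | summand a b) root_row b.
Proof.
elim/positive_ind => [b sb|b c pb sc ebc IH].
  by rewrite (big_pred1 b) // => c; apply: summand_simple.
rewrite (bigD1 c) /=; last by rewrite summand_cat // eqxx orbT.
rewrite (eq_bigl (summand b)) => [|b']; last first.
  rewrite summand_cat //; case: eqP => [->|_]; last by rewrite orbF andbT.
  by rewrite andbF /summand ebc ltnn !andbF.
by rewrite -IH /root_row /= ebc addrC addrA subrK.
Qed.

(** By induction the l-th iterate of a is the sum of the simple roots tau^l(b) over the summands b
    of a. All coefficients are nonnegative, so nothing cancels: a tau^l(b) outside G1 would occur
    with positive coefficient, while elements of the span of G1 have coefficient 0 there. *)
Lemma tau_definedP m a : positive a -> tau_defined G1 tau m a -> chain m a.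
Proof.
move=> pa /forallP def b ub l; elim/ltn_ind: l b ub => l IHl b ub ltlm.
have ch : chain l a by move=> b' ub' l' lt'; apply: IHl => //; apply: ltn_trans ltlm.
have expand l' : (l' <= l)%N ->
    iter l' (tau_ext G1 tau) (root_row a) = \sum_(b' | summand a b') root_row (iter l' tau b').
  elim: l' => [|l' IH] le; first exact: root_row_sum.
  rewrite iterS IH ?(ltnW le) // linear_sum; apply: eq_bigr => b' ub' /=.
  by rewrite tau_ext_root //; apply: ch.
have := def (Ordinal ltlm); rewrite /= expand // => insp.
apply/negPn/negP => nG; have sb := iter_tau_simple ch ub.
have: psum (iter l tau b).1
    (\sum_(b' | summand a b') root_row (iter l tau b')) = 0.
  apply: (psum_span insp) => c Gc; apply: contra nG => /eqP e.
  by rewrite -(simple_inj (triple_simple Gc) sb e).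
rewrite linear_sum (bigD1 b) //= psum_simple // eqxx => /eqP.
rewrite Order.POrderTheory.gt_eqF // Num.Theory.ltr_pwDl ?Num.Theory.ltr01 //.
apply: Num.Theory.sumr_ge0 => c /andP[uc _].
by rewrite psum_simple ?Num.Theory.ler0n //; apply: iter_tau_simple uc.
Qed.

End Triple.

(** * Strictly lower triangular and parabolic matrices *)

Section MatrixShape.
Variables (k : fieldType) (n : nat).
Implicit Types (M N : 'M[k]_n) (G : {set 'I_n * 'I_n}) (h : nat).

Definition lower h M := forall i l : 'I_n, M i l != 0 -> (l + h <= i)%N.

(* Stabilizes the span of the first b.1 + 1 basis vectors for every simple    *)
(* root b outside G.                                                          *)
Definition parabolic G M := forall b, b \in simple_roots n -> b \notin G ->
  forall i l : 'I_n, (l <= b.1)%N -> (b.1 < i)%N -> M i l = 0.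

Lemma lower_mul h h' M N : lower h M -> lower h' N -> lower (h' + h) (M *m N).
Proof.
move=> lM lN i l; apply: contraR; rewrite -ltnNge => lt; rewrite mxE.
apply/eqP/big1 => s _; apply/eqP; rewrite mulf_eq0 -implyNb; apply/implyP => /lM le.
by apply/negPn/negP => /lN le'; move: lt le le'; lia.
Qed.

Lemma lowerB h M N : lower h M -> lower h N -> lower h (M - N).
Proof.
move=> lM lN i l; apply: contraR => nle.
rewrite !mxE; have /eqP-> : M i l == 0 by apply: contraR nle; apply: lM.
by have /eqP-> : N i l == 0; [apply: contraR nle; apply: lN|rewrite subrr].
Qed.

Lemma parabolic_mul G M N : parabolic G M -> parabolic G N -> parabolic G (M *m N).
Proof.
move=> pM pN b sb nb i l le lt; rewrite mxE big1 // => s _.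
have [les|lts] := leqP s b.1; first by rewrite (pM b) ?mul0r.
by rewrite (pN b) ?mulr0.
Qed.

Lemma parabolicD G M N : parabolic G M -> parabolic G N -> parabolic G (M + N).
Proof.
by move=> pM pN b sb nb i l le lt; rewrite !mxE (pM b) // (pN b) // addr0.
Qed.

Lemma parabolicZ G c M : parabolic G M -> parabolic G (c *: M).
Proof. by move=> pM b sb nb i l le lt; rewrite !mxE (pM b) ?mulr0. Qed.

Lemma parabolicB G M N : parabolic G M -> parabolic G N -> parabolic G (M - N).
Proof. by move=> pM pN; rewrite -scaleN1r; apply/parabolicD/parabolicZ. Qed.

Lemma parabolic_upper G M : (forall i l : 'I_n, M i l != 0 -> (i <= l)%N) -> parabolic G M.
Proof.
move=> up b sb nb i l le lt; apply/eqP/negPn/negP => /up.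
by rewrite leqNgt (leq_ltn_trans le lt).
Qed.

End MatrixShape.

(** * Iterates of the Belavin-Drinfeld isomorphism on negative root vectors *)

Section ThetaStructure.
Variables (k : fieldType) (n : nat).
Notation g := (subvs_of (sl k n)).
Variables (G1 G2 : {set 'I_n * 'I_n}) (tau : 'I_n * 'I_n -> 'I_n * 'I_n).
Hypothesis triple : admissible_triple G1 G2 tau.
Variable th : 'End(g).
Hypothesis th_theta : is_theta G1 G2 tau th.
Implicit Types (a b c : 'I_n * 'I_n) (m l : nat).

Let ng a : g := root_vec k (oppr_root a).
Let g1 : g -> Prop := generated_subalgebra (@simple_vectors k n G1).

Lemma neg_root_vecE a : positive a -> vsval (ng a) = delta_mx a.2 a.1.
Proof.
move=> pa; rewrite /ng root_vecE //= -val_eqE /=.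
by move: pa; rewrite /positive; lia.
Qed.

Lemma gen_bracket (x y : g) : g1 x -> g1 y -> g1 (sl_bracket x y).
Proof. by move=> gx gy U sU bU; apply: (bU _ _ (gx U sU bU) (gy U sU bU)). Qed.

Lemma gen_simple a : a \in G1 -> g1 (ng a).
Proof. by move=> Ga U sU _; apply: sU; exists a => //; right. Qed.

Lemma chain_simple m b l : b \in simple_roots n -> chain G1 tau m b -> (l < m)%N ->
  iter l tau b \in G1.
Proof. by move=> sb ch; apply: ch; rewrite summand_simple. Qed.

Lemma theta_iter_simple m b : b \in simple_roots n -> chain G1 tau m b ->
  iter m th (ng b) = ng (iter m tau b).
Proof.
move=> sb; elim: m => // m IHm ch; rewrite !iterS IHm; last exact: chainW ch.
by case: th_theta => _ _ _ /(_ _ (chain_simple sb ch (ltnSn m))) [].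
Qed.

Lemma neg_root_bracket a b : positive a -> b \in simple_roots n -> a.2 = b.1 ->
  ng (a.1, b.2) = sl_bracket (ng b) (ng a).
Proof.
move=> pa sb e; have pb := simple_positive sb; apply: subvs_inj.
rewrite sl_bracketE !neg_root_vecE //; last first.
  by move: pa pb; rewrite /positive /= e; apply: ltn_trans.
rewrite e mul_delta_mx mul_delta_mx_0 ?subr0 //=.
by move: pa pb; rewrite /positive e -val_eqE /=; lia.
Qed.

Lemma theta_iter_bracket m (x y : g) :
  (forall l, (l < m)%N -> g1 (iter l th x)) ->
  (forall l, (l < m)%N -> g1 (iter l th y)) ->
  iter m th (sl_bracket x y) = sl_bracket (iter m th x) (iter m th y).
Proof.
elim: m => // m IHm gx gy; rewrite !iterS IHm.
- by case: th_theta => hom _ _ _; apply: hom; [apply: gx|apply: gy].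
- by move=> l lt; apply: gx; apply: ltnW.
- by move=> l lt; apply: gy; apply: ltnW.
Qed.

Lemma chain_catl m a b : positive a -> b \in simple_roots n -> a.2 = b.1 ->
  chain G1 tau m (a.1, b.2) -> chain G1 tau m a.
Proof. by move=> pa sb e; apply: chain_sub => c ac; rewrite summand_cat // ac. Qed.

Lemma chain_catr m a b : positive a -> b \in simple_roots n -> a.2 = b.1 ->
  chain G1 tau m (a.1, b.2) -> chain G1 tau m b.
Proof.
by move=> pa sb e; apply: chain_sub => c; rewrite summand_simple // summand_cat // orbC => ->.
Qed.

(** [th] respects brackets only on the subalgebra generated by G1, so expanding its iterates on
    e_(-a) requires the earlier iterates to stay there. *)
Lemma theta_iter_gen a : positive a ->
  forall m, chain G1 tau m.+1 a -> g1 (iter m th (ng a)).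
Proof.
elim/positive_ind => [b sb|a' b pa sb e IH] m ch.
  rewrite theta_iter_simple //; last exact: chainW ch.
  exact/gen_simple/(chain_simple sb ch).
have gb l : (l <= m)%N -> g1 (iter l th (ng b)).
  move=> le; have chb : chain G1 tau l.+1 b by apply: chainW (chain_catr pa sb e ch).
  rewrite theta_iter_simple //; last exact: chainW chb.
  exact/gen_simple/(chain_simple sb chb).
have ga l : (l <= m)%N -> g1 (iter l th (ng a')).
  by move=> le; apply: IH; apply: chainW (chain_catl pa sb e ch).
rewrite neg_root_bracket // theta_iter_bracket; first by apply: gen_bracket; auto.
- by move=> l /ltnW; apply: gb.
- by move=> l /ltnW; apply: ga.
Qed.

Lemma theta_iter_cat m a b : positive a -> b \in simple_roots n -> a.2 = b.1 ->
  chain G1 tau m (a.1, b.2) ->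
  iter m th (ng (a.1, b.2)) = sl_bracket (iter m th (ng b)) (iter m th (ng a)).
Proof.
move=> pa sb e ch; rewrite neg_root_bracket // theta_iter_bracket // => l lt.
- apply: theta_iter_gen (simple_positive sb) _ _.
  exact: chainW (chain_catr pa sb e ch).
- by apply: theta_iter_gen => //; apply: chainW (chain_catl pa sb e ch).
Qed.

Let chain_iter_simple m b : b \in simple_roots n -> chain G1 tau m b ->
  iter m tau b \in simple_roots n.
Proof. by move=> sb ch; apply: (iter_tau_simple triple ch); rewrite summand_simple. Qed.

Lemma theta_iter_simpleE m b : b \in simple_roots n -> chain G1 tau m b ->
  vsval (iter m th (ng b)) = delta_mx (iter m tau b).2 (iter m tau b).1.
Proof.
move=> sb ch; rewrite theta_iter_simple // neg_root_vecE //.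
exact/simple_positive/chain_iter_simple.
Qed.

(** The iterates preserve height: e_(-a) is an iterated bracket of simple negative root vectors,
    each sent to another such vector one step below the diagonal. *)
Lemma theta_iter_lower m a : positive a -> chain G1 tau m a ->
  lower (a.2 - a.1) (vsval (iter m th (ng a))).
Proof.
have base b : b \in simple_roots n -> chain G1 tau m b ->
    lower 1 (vsval (iter m th (ng b))).
  move=> sb ch i l; rewrite theta_iter_simpleE // mxE.
  case: andP => [[/eqP-> /eqP->] _|]; last by rewrite eqxx.
  by rewrite addn1; have /simpleP -> := chain_iter_simple sb ch.
elim/positive_ind => [b sb ch|a' b pa sb e IH ch].
  by move/simpleP: (sb) => ->; rewrite subSnn; apply: base.
have la := IH (chain_catl pa sb e ch); have lb := base _ sb (chain_catr pa sb e ch).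
rewrite theta_iter_cat // sl_bracketE /=.
have -> : (b.2 - a'.1 = (a'.2 - a'.1) + 1)%N.
  by move/simpleP: sb pa => ->; rewrite /positive -e; lia.
apply: lowerB; first exact: lower_mul.
by rewrite addnC; apply: lower_mul.
Qed.

(** For m > 0 the image is a bracket of vectors e_(-c) with c in G2, each of which preserves the
    flag steps at simple roots outside G2. *)
Lemma theta_iter_parabolic m a : (0 < m)%N -> positive a -> chain G1 tau m a ->
  parabolic G2 (vsval (iter m th (ng a))).
Proof.
move=> m0.
have base b : b \in simple_roots n -> chain G1 tau m b ->
    parabolic G2 (vsval (iter m th (ng b))).
  move=> sb ch c sc nc i l le lt; rewrite theta_iter_simpleE // mxE.
  case: andP => // -[/eqP ei /eqP el]; case/negP: nc.
  have tG2 : iter m tau b \in G2.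
    by case: m m0 ch {ei el} => // m' _ ch; apply/(triple_tau triple)/(chain_simple sb ch).
  suff -> : c = iter m tau b by [].
  have sm := chain_iter_simple sb ch; apply: simple_inj => //.
  by apply: val_inj; move: le lt; rewrite ei el; move/simpleP: sm => -> /=; lia.
elim/positive_ind => [b sb|a' b pa sb e IH ch]; first exact: base.
have pb := base _ sb (chain_catr pa sb e ch).
have pa' := IH (chain_catl pa sb e ch).
by rewrite theta_iter_cat // sl_bracketE; apply: parabolicB; apply: parabolic_mul.
Qed.

End ThetaStructure.

(** * Supports of tensors *)

Section Contraction.
Variables (k : fieldType) (n : nat).
Notation g := (subvs_of (sl k n)).
Implicit Types (P Q M : 'M[k]_n) (t : tensor g g).

Lemma contr_is_linear P : linear (contr P).
Proof.
move=> c t t'; apply: mxtrace_mulP => Q.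
by rewrite mulmxDr -scalemxAr mxtraceD mxtraceZ -!ev_contr linearP.
Qed.

HB.instance Definition _ P :=
  GRing.isLinear.Build k (tensor g g) 'M[k]_n *:%R (contr P) (contr_is_linear P).

Lemma contl_is_linear Q : linear (contl Q).
Proof.
move=> c t t'; apply: mxtrace_mulP => P.
by rewrite mulmxDr -scalemxAr mxtraceD mxtraceZ -!ev_contl linearP.
Qed.

HB.instance Definition _ Q :=
  GRing.isLinear.Build k (tensor g g) 'M[k]_n *:%R (contl Q) (contl_is_linear Q).

Lemma contr_tens P (x y : g) : contr P (tens x y) = \tr (P *m vsval x) *: vsval y.
Proof.
by apply: mxtrace_mulP => Q; rewrite -ev_contr ev_tens -scalemxAr mxtraceZ.
Qed.

Lemma contl_tens Q (x y : g) : contl Q (tens x y) = \tr (Q *m vsval y) *: vsval x.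
Proof.
by apply: mxtrace_mulP => P; rewrite -ev_contl ev_tens -scalemxAr mxtraceZ mulrC.
Qed.

Definition right_support t M := exists P, contr P t = M.

Lemma right_supportD t M N : right_support t M -> right_support t N ->
  right_support t (M + N).
Proof.
move=> [P <-] [P' <-]; exists (P + P'); apply: mxtrace_mulP => Q.
by rewrite mulmxDr mxtraceD -!ev_contr evDl.
Qed.

Lemma right_supportZ t c M : right_support t M -> right_support t (c *: M).
Proof.
move=> [P <-]; exists (c *: P); apply: mxtrace_mulP => Q.
by rewrite -scalemxAr mxtraceZ -!ev_contr evZl.
Qed.

Lemma right_support0 t : right_support t 0.
Proof. by rewrite -(scale0r (contr 0 t)); apply: right_supportZ; exists 0. Qed.

End Contraction.

(** * The supports of a Belavin-Drinfeld r-matrix *)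

Section RMatrix.
Variables (k : fieldType) (n : nat).
Notation g := (subvs_of (sl k n)).
Variables (G1 G2 : {set 'I_n * 'I_n}) (tau : 'I_n * 'I_n -> 'I_n * 'I_n).
Hypothesis triple : admissible_triple G1 G2 tau.
Variable r : tensor g g.
Hypothesis r_bd : is_bd_rmatrix G1 G2 tau r.
Implicit Types (a b c : 'I_n * 'I_n) (m l : nat).

Lemma pos_root_vecE a : positive a -> vsval (root_vec k a) = delta_mx a.1 a.2.
Proof.
move=> pa; rewrite root_vecE //= -val_eqE /=.
by move: pa; rewrite /positive; lia.
Qed.

(** The left legs of r are diagonal matrices, positive root vectors, or th^m(e_(-a)) with m > 0;
    only the last go below the diagonal, and they stay within G2. *)
Lemma contl_parabolic Q : parabolic G2 (contl Q r).
Proof.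
have [r0 [th [[[s /allP diag_s ->] _ _] thP ->]]] := r_bd.
have par0 : parabolic G2 (0 : 'M[k]_n) by move=> *; rewrite mxE.
have par_pos a M : positive a -> contl Q (tens (root_vec k a) M) = 
    \tr (Q *m vsval M) *: delta_mx a.1 a.2.
  by move=> pa; rewrite contl_tens pos_root_vecE.
have up_pos a (z : k) : positive a -> parabolic G2 (z *: delta_mx a.1 a.2 : 'M[k]_n).
  move=> pa; apply: parabolic_upper => i l; rewrite !mxE.
  case: andP => [[/eqP-> /eqP->] _|]; last by rewrite mulr0 eqxx.
  exact: ltnW.
rewrite linearD; apply: parabolicD.
  rewrite linear_sum big_seq; apply: big_ind => //; first exact: parabolicD.
  move=> p /diag_s /andP[dp _] /=; rewrite contl_tens.
  apply: parabolic_upper => i l; rewrite mxE; apply: contraNT => nle.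
  by rewrite (is_diag_mxP dp) ?mulr0 //; apply: contraNneq nle => ->.
rewrite linearD; apply: parabolicD.
  rewrite linear_sum; apply: big_ind => //; first exact: parabolicD.
  by move=> a pa /=; rewrite par_pos //; apply: up_pos.
rewrite linear_sum; apply: big_ind => //; first exact: parabolicD.
move=> a /andP[pa _] /=; rewrite linear_sum big_nat_cond.
apply: big_ind => //; first exact: parabolicD.
move=> m /andP[/andP[m0 _] def] /=; rewrite linearB /= par_pos // contl_tens.
apply: parabolicB; first exact: up_pos.
apply: parabolicZ; apply: (theta_iter_parabolic triple thP) => //.
exact: (tau_definedP triple pa def).
Qed.

(* Both factors of r0 are diagonal, so off-diagonal matrix units see only r1. *)
Lemma contr_bd (i j : 'I_n) : i != j -> exists2 th, is_theta G1 G2 tau th &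
  contr (delta_mx i j) r =
    \sum_(a | positive a) ((j == a.1) && (i == a.2))%:R *: delta_mx a.2 a.1
    + \sum_(a | positive a && (root_row a \in root_span G1))
        \sum_(1 <= m < #|G1|.+1 | tau_defined G1 tau m a)
          let x := vsval (iter m th (root_vec k (oppr_root a))) in
          (((j == a.1) && (i == a.2))%:R *: x - x j i *: delta_mx a.1 a.2).
Proof.
move=> nij; have [r0 [th [[[s /allP diag_s ->] _ _] thP ->]]] := r_bd.
exists th => //; rewrite linearD linear_sum big_seq big1 => [|p /diag_s /andP[dp _]].
  rewrite add0r linearD !linear_sum; congr (_ + _); apply: eq_bigr.
    move=> a pa /=.
    by rewrite contr_tens mxtrace_delta_mul pos_root_vecE // neg_root_vecE // mxE.
  move=> a /andP[pa _] /=; rewrite linear_sum; apply: eq_bigr => m _ /=.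
  by rewrite linearB /= !contr_tens !mxtrace_delta_mul pos_root_vecE // mxE.
by rewrite /= contr_tens mxtrace_delta_mul (is_diag_mxP dp) ?scale0r // eq_sym.
Qed.

Lemma tau_chain_end b : b \in simple_roots n -> exists2 e,
  forall l, (l < e)%N -> iter l tau b \in G1 & iter e tau b \notin G1.
Proof.
move=> sb; have ex : exists e, iter e tau b \notin G1.
  have [Gb|nG] := boolP (b \in G1); last by exists 0.
  by case: triple => _ _ _ _ /(_ _ Gb).
have [e ne emin] := ex_minnP ex; exists e => // l lt.
by apply/negPn/negP => /emin; rewrite leqNgt lt.
Qed.

(** Contracting the left leg against e_b yields e_(-b) plus the sum of the e_(-tau^m(b)), m > 0.
    Induction on the number of steps before the tau-chain of b leaves G1 removes the extra terms. *)
Lemma right_support_neg_simple b : b \in simple_roots n ->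
  right_support r (delta_mx b.2 b.1).
Proof.
move=> sb; have [e] := tau_chain_end sb; have [N] := ubnP e.
elim: N => // N IHN in b sb e *; move=> leN chb endb.
have pb := simple_positive sb.
have nb : b.2 != b.1 by rewrite -val_eqE /=; move: pb; rewrite /positive; lia.
have [th thP row_b] := contr_bd nb.
have eqb a : ((b.1 == a.1) && (b.2 == a.2)) = (a == b).
  by case: a => a1 a2; rewrite (eq_sym b.1) (eq_sym b.2); case: (b) => b1 b2.
have chain_le m : chain G1 tau m b -> (m <= e)%N.
  move=> ch; rewrite leqNgt; apply: contra endb => lt.
  by apply: ch => //; rewrite summand_simple.
pose rest := \sum_(1 <= m < #|G1|.+1 | tau_defined G1 tau m b && (root_row b \in root_span G1))
   vsval (iter m th (root_vec k (oppr_root b))).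
have {}row_b : contr (delta_mx b.2 b.1) r = delta_mx b.2 b.1 + rest.
  rewrite row_b; congr (_ + _).
    rewrite (bigD1 b) //= !eqxx scale1r big1 ?addr0 // => a /andP[_ na].
    by rewrite eqb (negPf na) scale0r.
  (* The flipped halves of the wedges do not interfere: their left legs are strictly lower, and
     (b.1, b.2) lies above the diagonal. *)
  have low a m : positive a -> tau_defined G1 tau m a ->
      vsval (iter m th (root_vec k (oppr_root a))) b.1 b.2 = 0.
    move=> pa def; apply/eqP/negPn/negP.
    move/(theta_iter_lower triple thP pa (tau_definedP triple pa def)).
    by move: pb; rewrite /positive; lia.
  rewrite /rest; have [spb|nspb] := boolP (root_row b \in root_span G1); last first.
    rewrite [RHS]big1 => [|m]; last by rewrite andbF.
    rewrite big1 // => a /andP[pa spa]; apply: big1 => m def /=.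
    rewrite low // scale0r subr0 eqb; case: eqP => [e'|_]; last by rewrite scale0r.
    by case/negP: nspb; rewrite -e'.
  rewrite (bigD1 b) ?pb //= [X in _ + X]big1 ?addr0 => [|a /andP[/andP[pa _] na]].
    by apply: eq_big => [m|m def]; rewrite ?andbT // !eqxx scale1r low // scale0r subr0.
  by apply: big1 => m def /=; rewrite low // scale0r subr0 eqb (negPf na) scale0r.
have -> : delta_mx b.2 b.1 = contr (delta_mx b.2 b.1) r + (-1) *: rest.
  by rewrite row_b scaleN1r addrK.
apply: right_supportD; first by exists (delta_mx b.2 b.1).
apply: right_supportZ; rewrite /rest big_nat_cond; apply: big_ind.
- exact: right_support0.
- exact: right_supportD.
move=> m /andP[/andP[m0 _] /andP[def _]].
have ch := tau_definedP triple pb def; have le := chain_le _ ch.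
rewrite (theta_iter_simpleE triple thP) //.
have sm : iter m tau b \in simple_roots n.
  by apply: (iter_tau_simple triple ch); rewrite summand_simple.
apply: (IHN _ sm (e - m)%N).
- by move: leN m0 le; lia.
- move=> l lt; rewrite -iterD; apply: chb; move: lt; lia.
- by rewrite -iterD subnK.
Qed.

(** With c = tau b, the vector e_(-c) occurs in a left leg of r only in - th(e_(-b)) (x) e_b, as b
    has no predecessor under [tau]. Contracting against it isolates -e_b. *)
Lemma right_support_source b : b \in G1 -> b \notin G2 ->
  right_support r (delta_mx b.1 b.2).
Proof.
move=> Gb nGb; pose c := tau b.
have sb := triple_simple triple Gb; have pb := simple_positive sb.
have sc : c \in simple_roots n := triple_simple2 triple (triple_tau triple Gb).
have pc := simple_positive sc.
have nc : c.1 != c.2 by rewrite -val_eqE /=; move: pc; rewrite /positive; lia.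
have [th thP row_c] := contr_bd nc.
have ge_c a : positive a -> ((c.2 == a.1) && (c.1 == a.2)) = false.
  by move=> pa; apply/andP => -[/eqP e1 /eqP e2]; move: pc pa; rewrite /positive e1 e2; lia.
have entry a m : positive a -> (0 < m)%N -> tau_defined G1 tau m a ->
    vsval (iter m th (root_vec k (oppr_root a))) c.2 c.1 = ((a == b) && (m == 1%N))%:R.
  move=> pa m0 def; have ch := tau_definedP triple pa def.
  have [sa|nsa] := boolP (a \in simple_roots n); last first.
    have -> : (a == b) = false by apply: contraNF nsa => /eqP->.
    apply/eqP/negPn/negP => /(theta_iter_lower triple thP pa ch).
    move/simpleP: sc => ->; move: nsa pa; rewrite inE /positive; lia.
  have Ga l : (l < m)%N -> iter l tau a \in G1 by apply: chain_simple ch.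
  rewrite (theta_iter_simpleE triple thP) // mxE.
  have -> : (c.2 == (iter m tau a).2) && (c.1 == (iter m tau a).1) = (iter m tau a == c).
    by case: (iter m tau a) => a1 a2; rewrite andbC (eq_sym c.1) (eq_sym c.2); case: (c).
  congr (nat_of_bool _)%:R.
  (* Injectivity of [tau] turns tau^(m+1)(a) = tau b into tau^m(a) = b, which for m > 0 would put b
     in G2. *)
  case: m m0 def ch Ga => // m _ _ _ Ga; rewrite eqSS iterS.
  apply/eqP/andP => [/(triple_inj triple (Ga m (ltnSn m)) Gb)|[/eqP-> /eqP->] //].
  case: m Ga => [|m] Ga /= e; first by rewrite e eqxx.
  by case/negP: nGb; rewrite -e; apply/(triple_tau triple)/Ga/ltnW.
have spb : root_row b \in root_span G1.
  have [i ->] : exists i : 'I_#|G1|, b = enum_val i.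
    by exists (enum_rank_in Gb b); rewrite enum_rankK_in.
  by rewrite -(nth_image 0 (@root_row n)) memv_span // mem_nth // size_tuple.
have def1 : tau_defined G1 tau 1 b by apply/forallP => l; rewrite ord1.
have G1_gt0 : (0 < #|G1|)%N by apply/card_gt0P; exists b.
(* The sign undoes the one of the second half of the wedge. *)
exists ((-1) *: delta_mx c.1 c.2); apply: mxtrace_mulP => Q.
rewrite -ev_contr evZl ev_contr mulN1r -linearN -mulmxN row_c; congr (\tr (Q *m _)).
rewrite big1 ?add0r => [|a pa]; last by rewrite ge_c // scale0r.
rewrite (bigD1 b) ?pb //= [X in _ + X]big1 ?addr0 => [|a /andP[/andP[pa _] na]]; last first.
  rewrite big_nat_cond big1 // => m /andP[/andP[m0 _] def].
  by rewrite ge_c // entry // (negPf na) !scale0r subr0.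
rewrite big_ltn_cond // def1 big_nat_cond big1 => [|m /andP[/andP[m1 _] def]].
  by rewrite ge_c // entry // !eqxx scale1r scale0r sub0r addr0 opprK.
by rewrite ge_c // entry ?(ltnW m1) // eqxx (gtn_eqF m1) !scale0r subr0.
Qed.

End RMatrix.

(** * Stable subspaces and the impossible flag *)

Section Flag.
Variables (k : fieldType) (n : nat).
Implicit Types (Z M l : 'M[k]_n) (b c : 'I_n * 'I_n).

(** The first q + 1 columns live in the first q rows, so by pigeonhole each term of the Leibniz
    formula has a zero factor. *)
Lemma det_zero_block M (q : 'I_n) :
  (forall i j : 'I_n, (q <= i)%N -> (j <= q)%N -> M i j = 0) -> \det M = 0.
Proof.
move=> M0; rewrite -det_tr /determinant big1 // => s _; apply/eqP.
rewrite mulf_eq0; apply/orP; right; apply/prodf_eq0.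
pose A := [set i : 'I_n | (i < q)%N].
have [/forallP sA|/forallPn [j]] := boolP [forall j, (j \in q |: A) ==> (s j \in A)].
  have: (#|s @: (q |: A)| <= #|A|)%N.
    by apply/subset_leq_card/subsetP => _ /imsetP[j /(implyP (sA j)) sj ->].
  by rewrite card_imset ?cardsU1 ?inE ?ltnn ?ltnn //; apply: perm_inj.
rewrite negb_imply !inE -leqNgt => /andP[jq qs]; exists j => //.
rewrite mxE M0 //; by case/orP: jq => [/eqP->|/ltnW].
Qed.

Lemma delta_mulcol (i j : 'I_n) (v : 'cV[k]_n) :
  delta_mx i j *m v = v j 0 *: delta_mx i 0.
Proof.
apply/colP => i'; rewrite !mxE (bigD1 j) //= big1 => [|l nl].
  by rewrite !mxE !eqxx andbT addr0 mulrC.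
by rewrite mxE (negPf nl) andbF mul0r.
Qed.

(** A space of dimension b.1 + 1 stable under all e_c is the span of the first b.1 + 1 basis
    vectors, which e_(-b) does not preserve. *)
Lemma parabolic_flag (G : {set 'I_n * 'I_n}) Z b :
  Z \in unitmx -> b \in simple_roots n -> b \notin G ->
  (forall c, c \in simple_roots n ->
     exists2 l, parabolic G l & delta_mx c.1 c.2 = Z *m l *m invmx Z) ->
  ~ exists2 l, parabolic G l & delta_mx b.2 b.1 = Z *m l *m invmx Z.
Proof.
move=> uZ sb nb simp low.
(* W is Z V, with V spanned by the basis vectors of index at most b.1. *)
pose W (v : 'cV[k]_n) := forall i : 'I_n, (b.1 < i)%N -> (invmx Z *m v) i 0 = 0.
have Wstab M v : (exists2 l, parabolic G l & M = Z *m l *m invmx Z) -> W v -> W (M *m v).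
  move=> [l pl ->] Wv i lt; rewrite !mulmxA mulVmx // mul1mx -mulmxA mxE big1 // => s _.
  by have [le|gt] := leqP s b.1; [rewrite (pl b) ?mul0r | rewrite Wv ?mulr0].
have WZ (z : k) v : z != 0 -> W (z *: v) -> W v.
  move=> c0 Wv i lt; have /eqP := Wv i lt.
  by rewrite -scalemxAr mxE mulf_eq0 (negPf c0) => /eqP.
have pos a : positive a -> forall v, W v -> W (delta_mx a.1 a.2 *m v).
  elim/positive_ind => [c sc v|a' c pa sc e IH v Wv]; first exact/Wstab/simp.
  rewrite -(mul_delta_mx a'.2) -mulmxA; apply: IH.
  by rewrite e; apply: Wstab => //; apply: simp.
have Wpos v (i s : 'I_n) : (i < s)%N -> W v -> v s 0 != 0 -> W (delta_mx i 0).
  move=> lt Wv vs; apply: (WZ _ _ vs); rewrite -delta_mulcol.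
  exact: (pos (i, s)).
have delta_nz (i : 'I_n) : (delta_mx i 0 : 'cV[k]_n) i 0 != 0.
  by rewrite mxE !eqxx oner_eq0.
have Wup : (exists v (s : 'I_n), [/\ W v, (b.1 <= s)%N & v s 0 != 0]) -> W (delta_mx b.2 0).
  move=> [v [s [Wv le vs]]].
  have [v' Wv' v'p] : exists2 v, W v & v b.1 0 != 0.
    move: le; rewrite leq_eqVlt => /orP[/eqP e|lt].
      by exists v => //; rewrite (val_inj e : b.1 = s).
    by exists (delta_mx b.1 0); [apply: Wpos lt Wv vs|].
  by apply: (WZ _ _ v'p); rewrite -delta_mulcol; apply: Wstab.
(* Either way W has the wrong dimension. If it reaches index b.1 or beyond, e_(-b) and the positive
   root vectors give it all basis vectors up to b.2, one too many, and [invmx Z] is singular.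
   Otherwise it sits in the span of the first b.1 vectors, and Z is singular. *)
have [ex|nex] := boolp.EM (exists v (s : 'I_n), [/\ W v, (b.1 <= s)%N & v s 0 != 0]).
  have Wb2 := Wup ex.
  have: \det (invmx Z) = 0.
    apply: (@det_zero_block _ b.2) => i j le lej.
    have Wj : W (delta_mx j 0).
      move: lej; rewrite leq_eqVlt => /orP[/eqP e|lt]; last exact: Wpos lt Wb2 _.
      by rewrite (val_inj e : j = b.2).
    have := Wj i; rewrite -colE mxE; apply.
    by move/simpleP: sb le => ->.
  by move/eqP; rewrite det_inv invr_eq0 => /eqP d0; move: uZ; rewrite unitmxE d0 unitr0.
have: \det Z = 0.
  apply: (@det_zero_block _ b.1) => i j le lej; apply/eqP/negPn/negP => nz.
  apply: nex; exists (col j Z), i; split; rewrite ?mxE // => i' lt.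
  rewrite colE mulmxA mulVmx // mul1mx mxE andbT.
  by case: eqP => // e; move: lt; rewrite e ltnNge lej.
by move=> d0; move: uZ; rewrite unitmxE d0 unitr0.
Qed.

End Flag.

(** * Conjugating the right support into the left one *)

Section Conclusion.
Variables (k : fieldType) (n : nat) (gam : {rmorphism k -> k}).
Notation g := (subvs_of (sl k n)).

Lemma contl_Ad (X Q : 'M[k]_n) (t : tensor g g) : X \in unitmx ->
  contl Q (tmap (Ad X) (Ad X) t) = X *m contl (invmx X *m Q *m X) t *m invmx X.
Proof.
move=> uX; apply: mxtrace_mulP => P; rewrite -ev_contl ev_Ad // ev_contl.
by rewrite !mulmxA [RHS]mxtrace_mulC !mulmxA.
Qed.

(** Since tw s = s^21, applying [theta] to X M X^-1 in the right support of s lands in its left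
    support, X L X^-1. Solving for M^T moves (gam X)^T across and produces Z; the sign of [theta] is
    absorbed by linearity. *)
Lemma support_conj (X : 'M[k]_n) (r : tensor g g) : X \in unitmx ->
  (forall P Q, ev P Q (tw gam (tmap (Ad X) (Ad X) r))
     = ev Q P (tmap (Ad X) (Ad X) r)) ->
  let Z := (map_mx gam X)^T *m X in
  forall M, right_support r M -> map_mx gam M = M ->
  exists Q, M^T = Z *m contl Q r *m invmx Z.
Proof.
move=> uX flip Z M [P PM] gM.
set s := tmap _ _ _ in flip.
pose P' := X *m P *m invmx X.
have cs : contr P' s = X *m M *m invmx X.
  by rewrite contr_Ad // /P' !mulmxA mulVmx // mul1mx mulmxKV // PM.
pose Y := (map_mx gam X)^T.
have uY : Y \in unitmx by rewrite unitmx_tr map_unitmx.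
have e : X *m contl (invmx X *m map_mx gam P'^T *m X) r *m invmx X
    = invmx Y *m M^T *m Y.
  rewrite -contl_Ad //; apply: mxtrace_mulP => Q; rewrite -ev_contl -flip ev_tw trmxK cs.
  by rewrite !map_mxM map_invmx gM !trmx_mul trmx_inv mulmxA.
exists (invmx X *m map_mx gam P'^T *m X).
have uZ : Z \in unitmx by rewrite unitmx_mul uY.
apply: (canRL (mulmxK uZ)); rewrite /Z -/Y mulmxA.
move/(congr1 (fun A => Y *m A *m X)): e.
by rewrite !mulmxA mulmxV // mul1mx mulmxKV.
Qed.

End Conclusion.

Theorem proposition6p3
  (F : fieldType) (charF : [pchar F] =i pred0)
  (d : F) (d_neq0 : d != 0) (d_nonsquare : forall c : F, c ^+ 2 != d)
  (K : splittingFieldType F) (sqrtd : K) (sqrtdP : sqrtd ^+ 2 = d%:A)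
  (KE : <<1%VS; sqrtd>>%VS = {:K}%VS)
  (sigma : gal_of {:K}) (sigma_gal : sigma \in 'Gal({:K} / 1)%g)
  (sigma_neq1 : sigma != 1%g)
  (Fbar : closedFieldType) (j : {rmorphism K -> Fbar})
  (Fbar_alg : forall x : Fbar, algebraicOver (j \o in_alg K) x)
  (n : nat) (n_gt0 : (0 < n)%N)
  (G1 G2 : {set 'I_n * 'I_n}) (tau : 'I_n * 'I_n -> 'I_n * 'I_n)
  (triple : admissible_triple G1 G2 tau)
  (r_BD : tensor (subvs_of (sl Fbar n)) (subvs_of (sl Fbar n)))
  (r_BDP : is_bd_rmatrix G1 G2 tau r_BD)
  (delta : 'Hom(subvs_of (su n sigma),
                tensor (subvs_of (su n sigma)) (subvs_of (su n sigma))))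
  (deltaP : is_lie_bialgebra (@su_bracket F K n sigma) delta)
  (delta_Fbar : 'Hom(subvs_of (sl Fbar n),
                     tensor (subvs_of (sl Fbar n)) (subvs_of (sl Fbar n))))
  (delta_FbarP : is_scalar_extension j delta delta_Fbar)
  (gauge : gauge_equivalent delta_Fbar (j sqrtd *: r_BD)) :
  G1 = set0 /\ G2 = set0.
Proof.
have natF m : (m%:R == 0 :> F) = (m == 0%N) by apply/pcharf0P: m.
have natK m : (m%:R == 0 :> K) = (m == 0%N).
  by rewrite -(rmorph_nat (in_alg K)) fmorph_eq0 natF.
have natL m : (m%:R == 0 :> Fbar) = (m == 0%N).
  by rewrite -(rmorph_nat j) fmorph_eq0 natK.
have sqrtd_neq0 : sqrtd != 0.
  apply: contraNneq d_neq0 => s0; move/eqP: sqrtdP.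
  by rewrite s0 expr0n eq_sym /= scaler_eq0 oner_eq0 orbF.
(* The image of sqrt d squares to d, so it is sqrt d up to sign; fixing sqrt d would fix K = F(sqrt
   d) and make [sigma] trivial. *)
have gal_sqrtd : sigma sqrtd = - sqrtd.
  have: (sigma sqrtd) ^+ 2 == sqrtd ^+ 2 
    by rewrite -rmorphXn sqrtdP; apply/eqP; exact: gal_alg.
  rewrite eqf_sqr => /orP[/eqP fix_sqrtd|/eqP//].
  case/negP: sigma_neq1; apply/gal_eqP => x _; rewrite gal_id.
  have: (<<1%VS; sqrtd>> <= fixedField [set sigma])%VS.
    apply/FadjoinP; split; first exact: sub1v.
    by apply/fixedFieldP; [exact: memvf | move=> s /set1P->].
  by rewrite KE => /subvP/(_ x (memvf x))/fixedFieldP -> //; rewrite ?inE ?memvf.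
have j_alg x : algebraicOver j x.
  have [p p0 px] := Fbar_alg x; exists (map_poly (in_alg K) p).
    by rewrite map_poly_eq0.
  by rewrite -map_poly_comp.
have [gam gam_j] := rmorphism_extension (j \o sigma) j_alg.
have [X uX cob] := gauge.
pose s := tmap (Ad X) (Ad X) r_BD.
have inv : forall A, ad_invariant (s + tw gam s) A.
  apply: (coboundary_twist gam_j sqrtd_neq0 gal_sqrtd _ _ delta_FbarP).
  - by rewrite natK.
  - by rewrite natK -lt0n.
  - by move=> a; rewrite cob tmapZ.
have sym P Q : ev P Q s + ev Q P s = \tr (P *m Q) - \tr P * \tr Q / n%:R.
  rewrite !ev_Ad // (ev_bd_sym _ _ _ r_BDP) ?natL -?lt0n //.
  have tr_conj M : \tr (invmx X *m M *m X) = \tr M.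
    by rewrite mxtrace_mulC mulmxA mulmxV // mul1mx.
  rewrite !tr_conj -(tr_conj (P *m Q)); congr (\tr _ - _).
  by rewrite !mulmxA mulmxK.
have flip : forall P Q, ev P Q (tw gam s) = ev Q P s.
  by apply: tw_flip sym inv; rewrite natL.
have conj := support_conj uX flip.
set Z := _ *m X in conj.
have uZ : Z \in unitmx by rewrite unitmx_mul unitmx_tr map_unitmx uX.
(* Matrix units are fixed by [gam], and transposition exchanges e_a and e_(-a): the e_(-c) of the
   right support yield e_c, and e_b yields e_(-b). *)
have {}conj p q : right_support r_BD (delta_mx p q) ->
    exists2 l, parabolic G2 l & delta_mx q p = Z *m l *m invmx Z.
  move=> supp; have [Q eQ] := conj _ supp (map_delta_mx _ _ _).
  exists (contl Q r_BD); first exact: contl_parabolic triple _ r_BDP _.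
  by rewrite -eQ trmx_delta.
have sub12 : G1 \subset G2.
  apply/subsetP => b Gb; apply/negPn/negP => nb.
  have sb := triple_simple triple Gb.
  apply: (parabolic_flag uZ sb nb).
    by move=> c sc; apply: conj; apply: right_support_neg_simple triple _ r_BDP _ sc.
  by apply: conj; apply: right_support_source triple _ r_BDP _ Gb nb.
have [_ _ [tau_inj tauG] _ nilp] := triple.
have eqG : G1 = G2.
  by apply/eqP; rewrite eqEcard sub12 -tauG (card_in_imset tau_inj) leqnn.
suff G10 : G1 = set0 by split=> //; rewrite -eqG.
apply/eqP/set0Pn => -[a Ga]; have [m] := nilp a Ga; case/negP.
elim: m => // m IHm; rewrite iterS eqG; exact: (triple_tau triple).
Qed.
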